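(* Let $\mathcal{H}$ be a real Hilbert space, $C\subset\mathcal{H}$ a nonempty closed convex set, $x_0\in C$, and $N\ge1$. For $1\le j\le N$ let $(T^{(j)}_n)_{n\ge0}$ be a sequence of nonexpansive mappings $T^{(j)}_n:C\to C$, and suppose that one of the following three cases holds, with $F$ defined accordingly. (Case 1) Each sequence is constant, $T^{(j)}_n=T^{(j)}$ for all $n$ and $1\le j\le N$, and $F=\bigcap_{1\le j\le N}\mathrm{Fix}(T^{(j)})$ is nonempty. (Case 2) $T^{(j)}_n=T^{(j)}(t_n)$, where for $1\le j\le N$, $\{T^{(j)}(t):t\ge0\}$ is a nonexpansive semigroup on $C$ and $(t_n)_{n\ge0}$ is a sequence of nonnegative real numbers with $\liminf_n t_n=0$, $\limsup_n t_n>0$ and $\lim_n(t_{n+1}-t_n)=0$; and $F=\bigcap_{1\le j\le N,\,t\ge0}\mathrm{Fix}(T^{(j)}(t))$ is nonempty. (Case 3) $T^{(j)}_nx=\frac1{t_n}\int_0^{t_n}T^{(j)}(s)x\,ds$ for $x\in C$, where for $1\le j\le N$, $\{T^{(j)}(t):t\ge0\}$ is a nonexpansive semigroup on $C$ and $(t_n)_{n\ge0}$ is a sequence of positive real numbers with $t_n\to+\infty$; and $F=\bigcap_{1\le j\le N,\,t\ge0}\mathrm{Fix}(T^{(j)}(t))$ is nonempty. Let $0<a<b<1$ and let $(\alpha^{(j)}_n)_{n\ge0}$, $1\le j\le N$, be real sequences with $\alpha^{(j)}_n\in(a,b)$ for $2\le j\le N$ and all $n$, and $\alpha^{(1)}_n\in[0,b)$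 for all $n$. Define $\Gamma^{(N+1)}_nx=x$ and, for $j=N,\dots,1$, $\Gamma^{(j)}_nx=\alpha^{(j)}_nx+(1-\alpha^{(j)}_n)T^{(j)}_n\Gamma^{(j+1)}_nx$ for $x\in C$. Put $R_n=\Gamma^{(1)}_n$ and $T_n=(R_n+\mathrm{Id})/2$. Then the sequence $(x_n)_{n\ge0}$ produced from $x_0$ by the Haugazeau-type algorithm associated with $(T_n)$, and likewise the sequence produced from $x_0$ by the shrinking projection algorithm associated with $(T_n)$, converges strongly to $P_Fx_0$.
   Context: $P_D$ denotes the metric projection onto a nonempty closed convex set $D$. $\mathrm{Fix}(T)=\{x\in C:Tx=x\}$. A mapping $T:C\to C$ is nonexpansive if $\|Tx-Ty\|\le\|x-y\|$ for all $x,y\in C$. A nonexpansive semigroup on $C$ is a family $\{T(t):t\ge0\}$ of mappings $C\to C$ such that: (i) $T(0)x=x$ for all $x\in C$; (ii) $T(s+t)=T(s)T(t)$ for all $s,t\ge0$; (iii) for each $x\in C$, $t\mapsto T(t)x$ is continuous; (iv) $\|T(t)x-T(t)y\|\le\|x-y\|$ for all $x,y\in C$, $t\ge0$. For $S\subset\mathcal{H}$, $H_S(x,y)=\{z\in S:\langle z-y,x-y\rangle\le0\}$ and $H(x,y)=H_{\mathcal{H}}(x,y)$. Haugazeau-type algorithm: given $x_0\in C$, $x_{n+1}=Q_C(x_0,x_n,T_nx_n)$, where $Q_C(x,y,z)$ is the metric projection (when it exists) of $x$ onto $H_C(x,y)\cap H_C(y,z)$. Shrinking projection algorithm: given $x_0\in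 C$ and $C_0=C$, set $C_{n+1}=C_n\cap H(x_n,T_nx_n)$ and $x_{n+1}=P_{C_{n+1}}x_0$ (the algorithm stops if $C_{n+1}=\emptyset$). *)

(* Defs.v *)
From Stdlib Require Export Reals.
From Coquelicot Require Export Coquelicot.

Set Implicit Arguments.
Unset Strict Implicit.
Unset Printing Implicit Defensive.

Open Scope R_scope.

Record HilbertSpace := {
  hilbert_space :> CompleteNormedModule R_AbsRing;
  inner : hilbert_space -> hilbert_space -> R;
  inner_sym : forall x y, inner x y = inner y x;
  inner_plus_l : forall x y z, inner (plus x y) z = inner x z + inner y z;
  inner_scal_l : forall (c : R) x y, inner (scal c x) y = c * inner x y;
  inner_norm : forall x, inner x x = norm x ^ 2
}.

Section Hilbert.

Variable H : HilbertSpace.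

(* Subsets of H are predicates.  A mapping C -> C is a function H -> H that
   preserves C; its values outside C are irrelevant. *)
Implicit Types (C D F S : H -> Prop) (x y z p : H).

Definition convex_set C : Prop :=
  forall x y (c : R), C x -> C y -> 0 <= c <= 1 ->
    C (plus (scal c x) (scal (1 - c) y)).

Definition is_proj D x p : Prop :=
  D p /\ forall y, D y -> norm (minus x p) <= norm (minus x y).

Definition self_map C (T : H -> H) : Prop := forall x, C x -> C (T x).

Definition nonexpansive C (T : H -> H) : Prop :=
  self_map C T /\
  forall x y, C x -> C y -> norm (minus (T x) (T y)) <= norm (minus x y).

Definition Fix C (T : H -> H) : H -> Prop := fun x => C x /\ T x = x.

(* T is only constrained at times t >= 0; continuity of t |-> T t x is relative
   to [0, +oo), hence one-sided at 0. *)
Definition nonexpansive_semigroup C (T : R -> H -> H) : Prop :=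
  (forall t, 0 <= t -> self_map C (T t)) /\
  (forall x, C x -> T 0 x = x) /\
  (forall s t x, 0 <= s -> 0 <= t -> C x -> T (s + t) x = T s (T t x)) /\
  (forall x, C x -> forall t, 0 <= t ->
     filterlim (fun s => T s x) (within (fun s => 0 <= s) (locally t))
       (locally (T t x))) /\
  (forall t x y, 0 <= t -> C x -> C y ->
     norm (minus (T t x) (T t y)) <= norm (minus x y)).

Definition halfspace S x y : H -> Prop :=
  fun z => S z /\ inner (minus z y) (minus x y) <= 0.

Definition whole : H -> Prop := fun _ => True.

Definition is_Q C x y z p : Prop :=
  is_proj (fun w => halfspace C x y w /\ halfspace C y z w) x p.

Definition haugazeau C (T : nat -> H -> H) x0 (x : nat -> H) : Prop :=
  x 0%nat = x0 /\ forall n, is_Q C x0 (x n) (T n (x n)) (x (S n)).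

Fixpoint shrinking_set C (T : nat -> H -> H) (x : nat -> H) (n : nat) :
    H -> Prop :=
  match n with
  | O => C
  | S m => fun z =>
      shrinking_set C T x m z /\ halfspace whole (x m) (T m (x m)) z
  end.

(* An infinite run: the requirement at rank n forces the set of rank n + 1 to
   be nonempty, so the algorithm never stops. *)
Definition shrinking C (T : nat -> H -> H) x0 (x : nat -> H) : Prop :=
  x 0%nat = x0 /\
  forall n, is_proj (shrinking_set C T x (S n)) x0 (x (S n)).

(* T j n and alpha j n stand for T^(j)_n and alpha^(j)_n with j = 1, ..., N. *)

Definition constant_case C (N : nat) (T : nat -> nat -> H -> H) F : Prop :=
  exists U : nat -> H -> H,
    (forall j n x, (1 <= j <= N)%nat -> C x -> T j n x = U j x) /\
    (forall x, F x <-> forall j, (1 <= j <= N)%nat -> Fix C (U j) x) /\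
    (exists x, F x).

Definition common_fixed_points C (N : nat) (U : nat -> R -> H -> H) :
    H -> Prop :=
  fun x => forall j t, (1 <= j <= N)%nat -> 0 <= t -> Fix C (U j t) x.

Definition semigroup_case C (N : nat) (T : nat -> nat -> H -> H) F : Prop :=
  exists (U : nat -> R -> H -> H) (t : nat -> R),
    (forall j, (1 <= j <= N)%nat -> nonexpansive_semigroup C (U j)) /\
    (forall n, 0 <= t n) /\
    LimInf_seq t = Finite 0 /\
    Rbar_lt (Finite 0) (LimSup_seq t) /\
    is_lim_seq (fun n => t (S n) - t n) (Finite 0) /\
    (forall j n x, (1 <= j <= N)%nat -> C x -> T j n x = U j (t n) x) /\
    (forall x, F x <-> common_fixed_points C N U x) /\
    (exists x, F x).

Definition mean_case C (N : nat) (T : nat -> nat -> H -> H) F : Prop :=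
  exists (U : nat -> R -> H -> H) (t : nat -> R),
    (forall j, (1 <= j <= N)%nat -> nonexpansive_semigroup C (U j)) /\
    (forall n, 0 < t n) /\
    is_lim_seq t p_infty /\
    (forall j n x, (1 <= j <= N)%nat -> C x ->
       T j n x = scal (/ t n) (RInt (fun s => U j s x) 0 (t n))) /\
    (forall x, F x <-> common_fixed_points C N U x) /\
    (exists x, F x).

(* Gamma_from k j n is Gamma^(j)_n when k mappings j, ..., j + k - 1 = N
   remain. *)
Fixpoint Gamma_from (alpha : nat -> nat -> R) (T : nat -> nat -> H -> H)
    (k j n : nat) x : H :=
  match k with
  | O => x
  | S k' => plus (scal (alpha j n) x)
              (scal (1 - alpha j n) (T j n (Gamma_from alpha T k' (S j) n x)))
  end.

Definition Gamma (N : nat) alpha T (j n : nat) x : H :=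
  Gamma_from alpha T (N + 1 - j) j n x.

Definition averaged_map (N : nat) alpha T (n : nat) x : H :=
  scal (/ 2) (plus (Gamma N alpha T 1 n x) x).

Definition converges (x : nat -> H) p : Prop :=
  filterlim x eventually (locally p).

End Hilbert.

(* Main.v *)
(* No weak topology is used.  In both algorithms |x_n - x_0| increases, x_n is
   the projection of x_0 onto a half-space containing F, and
   |T_n x_n - x_n| -> 0.  With p = P_F x_0 this gives
   |p - x_n|^2 <= |p - x_0|^2 - |x_n - x_0|^2, so it suffices to find c in F
   with |c - x_0| <= lim |x_n - x_0|.  Going back through the Gamma^(j), the
   displacements of all the T^(j)_n at x_n vanish.  The asymptotic center c of a
   subsequence, i.e. the minimiser over C of y |-> limsup |x_n - y|^2, satisfies
   that norm bound and is fixed by every nonexpansive map whose displacement at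
   the x_n vanishes.  In case 2 the subsequences along which t_n -> s / 2^m
   provide such points for U(s / 2^m), and the nested closed convex sets of
   these fixed points have a common point near x_0, fixed by U(t) for all t by
   density.  In case 3, |U(h) A_t x - A_t x|^2 = O(h / t) for the means A_t. *)

From Stdlib Require Import Lra Lia ClassicalEpsilon.
Require Import Defs.

Set Implicit Arguments.
Unset Strict Implicit.
Unset Printing Implicit Defensive.

(** * Inner products and squared distances *)

(** A weak cluster point would be the usual candidate for the point of [F]. The asymptotic center is
    obtained instead as the metric projection is, by minimising a uniformly convex functional, so
    one lemma yields both. Its strengthened minimality, in which the value at [y] exceeds the
    minimum by at least |y - c|^2, gives the norm bound when applied to [x0] and the fixed point
    property when applied to the image of [c]. The center depends on the sequence alone and not on
    the maps, so a single point is fixed for all [j] at once. In case 2 it does depend on the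
    subsequence, hence on the limit time, and centers for different times are unrelated. Dyadic
    times are used because [U (s / 2 ^ m)] is the square of [U (s / 2 ^ (m + 1))], which makes the
    fixed point sets decrease with [m]. Since alpha^(1) may vanish, the outermost level of the
    composition cannot be treated like the others: its displacement is recovered from the factor 1 -
    alpha^(1) alone. *)

Lemma inner_plus_r (H : HilbertSpace) (x y z : H) :
  inner z (plus x y) = inner z x + inner z y.
Proof. now rewrite inner_sym, inner_plus_l, !(inner_sym z). Qed.

Lemma inner_scal_r (H : HilbertSpace) (c : R) (x y : H) :
  inner x (scal c y) = c * inner x y.
Proof. now rewrite inner_sym, inner_scal_l, (inner_sym x). Qed.

Lemma inner_zero_l (H : HilbertSpace) (x : H) : inner zero x = 0.
Proof.
  pose proof (inner_plus_l zero zero x) as e. rewrite plus_zero_l in e. lra.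
Qed.

(* Restated because [rewrite] does not see through the canonical structures. *)
Lemma hplus_opp_r (H : HilbertSpace) (x : H) : plus x (opp x) = zero.
Proof. exact (plus_opp_r x). Qed.

Lemma hplus_opp_l (H : HilbertSpace) (x : H) : plus (opp x) x = zero.
Proof. exact (plus_opp_l x). Qed.

Lemma inner_opp_l (H : HilbertSpace) (x y : H) :
  inner (opp x) y = - inner x y.
Proof.
  pose proof (inner_plus_l x (opp x) y) as e.
  rewrite hplus_opp_r, inner_zero_l in e. lra.
Qed.

Lemma inner_opp_r (H : HilbertSpace) (x y : H) :
  inner x (opp y) = - inner x y.
Proof. now rewrite inner_sym, inner_opp_l, (inner_sym x). Qed.

Lemma inner_zero_r (H : HilbertSpace) (x : H) : inner x zero = 0.
Proof. now rewrite inner_sym, inner_zero_l. Qed.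

Lemma inner_minus_l (H : HilbertSpace) (x y z : H) :
  inner (minus x y) z = inner x z - inner y z.
Proof.
  transitivity (inner (plus x (opp y)) z); [reflexivity|].
  rewrite inner_plus_l, inner_opp_l. ring.
Qed.

Lemma inner_minus_r (H : HilbertSpace) (x y z : H) :
  inner z (minus x y) = inner z x - inner z y.
Proof. now rewrite inner_sym, inner_minus_l, !(inner_sym z). Qed.

(** The second loop keeps one orientation of each inner product, so that [ring] and [lra] see
    [inner x y] and [inner y x] as one atom. *)
Ltac expand_inner :=
  repeat rewrite ?inner_minus_l, ?inner_minus_r, ?inner_plus_l,
    ?inner_plus_r, ?inner_scal_l, ?inner_scal_r,
    ?inner_opp_l, ?inner_opp_r, ?inner_zero_l, ?inner_zero_r;
  repeat match goal with
  | |- context [inner ?x ?y] =>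
      match goal with
      | |- context [inner y x] =>
          tryif constr_eq x y then fail else rewrite (inner_sym y x)
      end
  end.

(** Squared distances are polynomial in inner products, so estimates on them reduce to real
    arithmetic without square roots. *)
Definition sqdist (H : HilbertSpace) (x y : H) : R :=
  inner (minus x y) (minus x y).

Ltac expand_sqdist := unfold sqdist; expand_inner.

Lemma inner_ge0 (H : HilbertSpace) (x : H) : 0 <= inner x x.
Proof. rewrite inner_norm. apply pow2_ge_0. Qed.

Lemma inner_eq0 (H : HilbertSpace) (x : H) : inner x x <= 0 -> x = zero.
Proof.
  rewrite inner_norm. intros h. apply (norm_eq_zero x).
  pose proof (norm_ge_0 x). nra.
Qed.

Lemma sqdist_norm (H : HilbertSpace) (x y : H) :
  sqdist x y = norm (minus x y) ^ 2.
Proof. apply inner_norm. Qed.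

Lemma sqdist_ge0 (H : HilbertSpace) (x y : H) : 0 <= sqdist x y.
Proof. apply inner_ge0. Qed.

Lemma sqdist_sym (H : HilbertSpace) (x y : H) : sqdist x y = sqdist y x.
Proof. expand_sqdist; ring. Qed.

Lemma sqdist_refl (H : HilbertSpace) (x : H) : sqdist x x = 0.
Proof. expand_sqdist; ring. Qed.

Lemma inner_ext (H : HilbertSpace) (x y : H) :
  (forall z, inner x z = inner y z) -> x = y.
Proof.
  intros e. assert (e0 : minus x y = zero).
  { apply inner_eq0. rewrite inner_minus_l, e. lra. }
  transitivity (plus x (plus (opp y) y)).
  { now rewrite hplus_opp_l, plus_zero_r. }
  transitivity (plus (minus x y) y); [apply plus_assoc|].
  now rewrite e0, plus_zero_l.
Qed.

Lemma sqdist_eq0 (H : HilbertSpace) (x y : H) : sqdist x y <= 0 -> x = y.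
Proof.
  intros h. apply inner_eq0 in h. apply inner_ext. intros z.
  pose proof (inner_zero_l z) as e. rewrite <- h in e.
  rewrite inner_minus_l in e. lra.
Qed.

Lemma sqdist_le_norm (H : HilbertSpace) (x y z w : H) :
  sqdist x y <= sqdist z w <-> norm (minus x y) <= norm (minus z w).
Proof.
  rewrite !sqdist_norm.
  pose proof (norm_ge_0 (minus x y)). pose proof (norm_ge_0 (minus z w)).
  split; intros; nra.
Qed.

(** Expand |e (x - y) - (y - z)|^2 >= 0 and divide by [e]. A small [e] keeps the coefficient of the
    main term near 1, which limit arguments need. *)
Lemma sqdist_triangle (H : HilbertSpace) (e : R) (x y z : H) : 0 < e ->
  sqdist x z <= (1 + e) * sqdist x y + (1 + / e) * sqdist y z.
Proof.
  intros he.
  pose proof (inner_ge0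
    (minus (scal e (minus x y)) (minus y z))) as h.
  assert (h' : 0 <= / e * inner (minus (scal e (minus x y)) (minus y z))
      (minus (scal e (minus x y)) (minus y z))).
  { apply Rmult_le_pos; [apply Rlt_le, Rinv_0_lt_compat|]; assumption. }
  revert h'. expand_sqdist. intros h'.
  apply Rminus_le_0. eapply Rle_trans; [exact h'|]. right. field. lra.
Qed.

Lemma sqdist_triangle2 (H : HilbertSpace) (x y z : H) :
  sqdist x z <= 2 * sqdist x y + 2 * sqdist y z.
Proof. pose proof (sqdist_triangle x y z Rlt_0_1). lra. Qed.

Definition segment (H : HilbertSpace) (c : R) (x y : H) : H :=
  plus (scal c x) (scal (1 - c) y).

(** The last term expresses the uniform convexity of the squared norm, the source of all strict
    gains below. *)
Lemma sqdist_segment (H : HilbertSpace) (c : R) (x y z : H) :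
  sqdist (segment c x y) z =
  c * sqdist x z + (1 - c) * sqdist y z - c * (1 - c) * sqdist x y.
Proof. unfold segment. expand_sqdist. ring. Qed.

(** * Strong convergence in terms of squared distances *)

Lemma pow2_lt (x y : R) : 0 <= x -> 0 <= y -> x ^ 2 < y ^ 2 <-> x < y.
Proof. intros; split; intros; nra. Qed.

Lemma converges_sqdist (H : HilbertSpace) (u : nat -> H) (l : H) :
  converges u l <-> is_lim_seq (fun n => sqdist (u n) l) 0.
Proof.
  unfold converges. rewrite <- is_lim_seq_spec.
  split; intros h; [|apply (filterlim_locally_ball_norm u l)]; intros eps.
  - assert (he : 0 < sqrt eps) by apply sqrt_lt_R0, cond_pos.
    destruct (proj1 (filterlim_locally_ball_norm u l) h (mkposreal _ he))
      as [N hN].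
    exists N. intros n hn. specialize (hN n hn). unfold ball_norm in hN.
    simpl in hN.
    rewrite Rminus_0_r, Rabs_pos_eq by apply sqdist_ge0.
    rewrite sqdist_norm.
    rewrite <- (pow2_sqrt eps (Rlt_le _ _ (cond_pos eps))).
    apply pow2_lt; [apply norm_ge_0 | apply sqrt_pos | exact hN].
  - assert (he : 0 < eps ^ 2) by apply pow_lt, cond_pos.
    destruct (h (mkposreal _ he)) as [N hN]. exists N. intros n hn.
    specialize (hN n hn). unfold ball_norm. simpl in hN.
    rewrite Rminus_0_r, Rabs_pos_eq in hN by apply sqdist_ge0.
    rewrite sqdist_norm in hN.
    apply pow2_lt; [apply norm_ge_0 | apply Rlt_le, cond_pos | exact hN].
Qed.

Lemma is_lim_seq_squeeze0 (u v : nat -> R) :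
  (forall n, 0 <= u n <= v n) -> is_lim_seq v 0 -> is_lim_seq u 0.
Proof.
  intros h hv. apply (is_lim_seq_le_le (fun _ => 0) u v); auto.
  apply is_lim_seq_const.
Qed.

Lemma is_lim_seq_lincomb0 (c d : R) (u v : nat -> R) :
  is_lim_seq u 0 -> is_lim_seq v 0 ->
  is_lim_seq (fun n => c * u n + d * v n) 0.
Proof.
  intros hu hv. replace 0 with (c * 0 + d * 0) by ring.
  apply is_lim_seq_plus'.
  - exact (is_lim_seq_scal_l u c 0 hu).
  - exact (is_lim_seq_scal_l v d 0 hv).
Qed.

Lemma is_lim_seq0_eventually (u : nat -> R) (eps : R) :
  is_lim_seq u 0 -> 0 < eps ->
  exists M, forall n, (M <= n)%nat -> Rabs (u n) < eps.
Proof.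
  intros h he. apply is_lim_seq_spec in h.
  destruct (h (mkposreal _ he)) as [M hM]. exists M. intros n hn.
  specialize (hM n hn). simpl in hM. now rewrite Rminus_0_r in hM.
Qed.

Lemma is_lim_seq_inv_S : is_lim_seq (fun n => / (INR n + 1)) 0.
Proof.
  apply (is_lim_seq_inv (fun n => INR n + 1) p_infty); [|discriminate].
  eapply is_lim_seq_ext; [intros n; apply S_INR|].
  apply (is_lim_seq_incr_1 INR), is_lim_seq_INR.
Qed.

Lemma inv_S_pos (n : nat) : 0 < / (INR n + 1).
Proof. apply Rinv_0_lt_compat. pose proof (pos_INR n). lra. Qed.

Lemma converges_subseq (H : HilbertSpace) (u : nat -> H) (l : H)
    (f : nat -> nat) :
  (forall n, (n <= f n)%nat) -> converges u l ->
  converges (fun n => u (f n)) l.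
Proof.
  intros hf h P hP. destruct (h P hP) as [M hM]. exists M. intros n hn.
  apply hM. specialize (hf n). lia.
Qed.

Lemma closed_seq (H : HilbertSpace) (C : H -> Prop) (u : nat -> H) (l : H) :
  closed C -> (forall n, C (u n)) -> converges u l -> C l.
Proof. intros hC hu hl. exact (closed_filterlim u C l hl hu hC). Qed.

Lemma sqdist_cauchy (H : HilbertSpace) (u : nat -> H) (e : nat -> R) :
  is_lim_seq e 0 ->
  (forall m n, (m <= n)%nat -> sqdist (u m) (u n) <= e m) ->
  exists l, converges u l.
Proof.
  intros he h. apply (filterlim_locally_cauchy (F := eventually) u). intros eps.
  (* Two squared distances to [u M], each below this bound and weighted by 2, stay below
     [eps ^ 2]. *)
  assert (hp : 0 < (eps ^ 2) / 4).
  { pose proof (pow_lt _ 2 (cond_pos eps)). lra. }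
  destruct (is_lim_seq0_eventually he hp) as [M hM].
  exists (fun n => (M <= n)%nat). split; [now exists M|].
  intros m n hm hn. apply (norm_compat1 (V := H)).
  pose proof (sqdist_triangle2 (u n) (u M) (u m)) as ht.
  rewrite (sqdist_sym (u n) (u M)) in ht.
  pose proof (h M m hm). pose proof (h M n hn). specialize (hM M (le_n M)).
  pose proof (Rle_abs (e M)).
  apply pow2_lt; [apply norm_ge_0 | apply Rlt_le, cond_pos |].
  rewrite <- sqdist_norm. lra.
Qed.
(** * Minimisers of uniformly convex functionals *)

(** Let [e] tend to 0, divide by [s], then let [s] tend to 0. *)
Lemma segment_limit_le (D r rho : R) : 0 <= D ->
  (forall s e, 0 <= s <= 1 -> 0 < e ->
     rho <= s * r + (1 - s) * (rho + e) - s * (1 - s) * D) ->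
  rho + D <= r.
Proof.
  intros hD h. apply Rnot_lt_le. intros hr.
  set (g := rho + D - r). assert (hg : 0 < g) by (unfold g; lra).
  (* After substituting [r = rho + D - g], the right side minus [rho] is
     [- s * g + s * s * D + (1 - s) * e]. This [s] makes the second term at most [s * g / 2], and
     [e = s * g / 4] leaves a negative total. *)
  set (s := g / (2 * (D + g))).
  assert (hs : 0 < s) by (unfold s; apply Rdiv_lt_0_compat; lra).
  assert (es : s * (2 * (D + g)) = g) by (unfold s; field; lra).
  assert (hs1 : s <= 1) by nra.
  assert (he : 0 < s * g / 4) by nra.
  specialize (h s (s * g / 4) (conj (Rlt_le _ _ hs) hs1) he).
  assert (er : r = rho + D - g) by (unfold g; ring).
  clearbody g s. subst r.
  assert (0 < s * g) by nra. assert (s * (s * (2 * D)) <= s * g) by nra.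
  nra.
Qed.

(* [E y r] means that [r] bounds the functional at [y]; its value there is the
   infimum of such [r].  Both the metric projection (squared distance to a point) and
   the asymptotic center of a bounded sequence (upper limit of the squared
   distances to its terms) are minimisers of this kind. *)
Lemma uniformly_convex_minimizer (H : HilbertSpace) (E : H -> R -> Prop) :
  (exists y r, E y r) ->
  (forall y r, E y r -> 0 <= r) ->
  (forall y r r', E y r -> r <= r' -> E y r') ->
  (forall y y' r r' s, E y r -> E y' r' -> 0 <= s <= 1 ->
     E (segment s y y') (s * r + (1 - s) * r' - s * (1 - s) * sqdist y y')) ->
  (forall u rho c, 0 <= rho -> (forall n, E (u n) (rho + / (INR n + 1))) ->
     converges u c -> forall e, 0 < e -> E c (rho + e)) ->
  exists c rho, 0 <= rho /\ (forall e, 0 < e -> E c (rho + e)) /\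
    forall y r, E y r -> rho + sqdist y c <= r.
Proof.
  intros [y0 [r0 h0]] pos mono cvx clos.
  (* The signs are reversed so that the supremum [m] gives the infimum [- m] of the bounds. *)
  destruct (completeness (fun r => exists y, E y (- r))) as [m [ub lub]].
  { exists 0. intros r [y hy]. specialize (pos _ _ hy). lra. }
  { exists (- r0), y0. now rewrite Ropp_involutive. }
  assert (lb : forall y r, E y r -> - m <= r).
  { intros y r hy. enough (- r <= m) by lra. apply ub. exists y.
    now rewrite Ropp_involutive. }
  assert (appr : forall n, exists y, E y (- m + / (INR n + 1))).
  { intros n. apply NNPP. intros hn.
    enough (m <= m - / (INR n + 1)) by (pose proof (inv_S_pos n); lra).
    apply lub. intros r [y hy]. apply Rnot_lt_le. intros hr. apply hn.
    exists y. apply (mono _ _ _ hy). lra. }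
  destruct (choice _ appr) as [u hu].
  (* The bound at the midpoint is at least [- m], so a quarter of the squared distance is at most
     the mean of the two errors, and the earlier error is the larger. The summand [0 * 0] only fits
     the shape of [is_lim_seq_lincomb0]. *)
  destruct (@sqdist_cauchy H u (fun n => 4 * / (INR n + 1) + 0 * 0))
    as [c hc].
  { apply is_lim_seq_lincomb0; [apply is_lim_seq_inv_S|].
    apply is_lim_seq_const. }
  { intros i j hij.
    pose proof (lb _ _ (cvx _ _ _ _ (/ 2) (hu i) (hu j) ltac:(lra))).
    assert (/ (INR j + 1) <= / (INR i + 1)).
    { apply Rinv_le_contravar; [pose proof (pos_INR i); lra|].
      apply le_INR in hij. lra. }
    lra. }
  assert (hm : 0 <= - m).
  { enough (m <= 0) by lra. apply lub. intros r [y hy].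
    specialize (pos _ _ hy). lra. }
  pose proof (clos u (- m) c hm hu hc) as Ec.
  exists c, (- m). repeat split; [assumption..|].
  intros y r hy. apply segment_limit_le; [apply sqdist_ge0|].
  intros s e hs he. exact (lb _ _ (cvx _ _ _ _ s hy (Ec e he) hs)).
Qed.

Lemma le_of_forall_eps (x y : R) : (forall e, 0 < e -> x <= y + e) -> x <= y.
Proof.
  intros h. apply Rnot_lt_le. intros hxy.
  specialize (h ((x - y) / 2) ltac:(lra)). lra.
Qed.

(** [M] is uniform in [x], which in [asymptotic_center] runs over the terms of a sequence. The
    weighted triangle inequality leaves the errors [d * r] and [(1 + / d) * sqdist (u n) c], each at
    most [e / 2]. *)
Lemma sqdist_eventually_le (H : HilbertSpace) (u : nat -> H) (c : H)
    (r e : R) : converges u c -> 0 <= r -> 0 < e ->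
  exists M, forall x n, (M <= n)%nat -> sqdist x (u n) <= r ->
    sqdist x c <= r + e.
Proof.
  intros hc hr he. apply converges_sqdist in hc.
  set (d := e / (2 * (r + 1))).
  assert (hd : 0 < d) by (unfold d; apply Rdiv_lt_0_compat; lra).
  assert (ed : d * (2 * (r + 1)) = e) by (unfold d; field; lra).
  assert (hd' : 0 < / d) by now apply Rinv_0_lt_compat.
  assert (hq : 0 < e / 2 / (1 + / d)) by (apply Rdiv_lt_0_compat; lra).
  destruct (is_lim_seq0_eventually hc hq) as [M hM].
  exists M. intros x n hn hx. specialize (hM n hn).
  rewrite Rabs_pos_eq in hM by apply sqdist_ge0.
  pose proof (sqdist_triangle x (u n) c hd) as ht.
  assert ((1 + / d) * sqdist (u n) c <= e / 2).
  { apply Rmult_lt_compat_l with (r := 1 + / d) in hM; [|lra].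
    replace ((1 + / d) * (e / 2 / (1 + / d))) with (e / 2) in hM
      by (field; split; nra). lra. }
  clearbody d. nra.
Qed.

(** The term [sqdist y p] encodes the obtuse angle at [p]. *)
Lemma projection_exists (H : HilbertSpace) (D : H -> Prop) (x : H) :
  (exists y, D y) -> convex_set D ->
  (forall u l, (forall n, D (u n)) -> converges u l -> D l) ->
  exists p, D p /\ forall y, D y -> sqdist x p + sqdist y p <= sqdist x y.
Proof.
  intros [y0 hy0] cvx clos.
  destruct (@uniformly_convex_minimizer H
    (fun y r => D y /\ sqdist x y <= r)) as [p [rho [_ [hp hmin]]]].
  - exists y0, (sqdist x y0). split; [assumption|lra].
  - intros y r [_ h]. pose proof (sqdist_ge0 x y). lra.
  - intros y r r' [h1 h2] h. split; [assumption|lra].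
  - intros y y' r r' s [h1 h2] [h3 h4] hs. split; [now apply cvx|].
    rewrite sqdist_sym, sqdist_segment, !(sqdist_sym _ x). nra.
  - intros u rho c hrho hu hc e he. split.
    + apply (clos u); [apply hu | assumption].
    + destruct (sqdist_eventually_le (r := rho + e / 2) (e := e / 2) hc)
        as [M hM]; [lra|lra|].
      destruct (is_lim_seq0_eventually is_lim_seq_inv_S
        (eps := e / 2)) as [M' hM']; [lra|].
      specialize (hM x (max M M') ltac:(lia)).
      specialize (hM' (max M M') ltac:(lia)).
      rewrite Rabs_pos_eq in hM' by apply Rlt_le, inv_S_pos.
      destruct (hu (max M M')). lra.
  - assert (Dp : D p) by apply (hp 1 Rlt_0_1).
    exists p. split; [assumption|]. intros y hy.
    assert (sqdist x p <= rho).
    { apply le_of_forall_eps. intros e he. apply (hp e he). }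
    pose proof (hmin y (sqdist x y) (conj hy (Rle_refl _))). lra.
Qed.

(** Compare [p] with the points [segment s y p] of [D] for small [s]. *)
Lemma projection_inner (H : HilbertSpace) (D : H -> Prop) (x p y : H) :
  convex_set D -> D p -> D y ->
  (forall z, D z -> sqdist x p <= sqdist x z) ->
  inner (minus y p) (minus x p) <= 0.
Proof.
  intros cvx hp hy hmin.
  enough (h : sqdist x p + sqdist y p <= sqdist x y).
  { revert h. expand_sqdist. lra. }
  apply segment_limit_le; [apply sqdist_ge0|]. intros s e hs he.
  pose proof (hmin _ (cvx y p s hy hp hs)) as h.
  change (plus (scal s y) (scal (1 - s) p)) with (segment s y p) in h.
  rewrite (sqdist_sym x (segment _ _ _)), sqdist_segment,
    !(sqdist_sym _ x) in h.
  nra.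
Qed.

Lemma is_proj_sqdist (H : HilbertSpace) (D : H -> Prop) (x p : H) :
  is_proj D x p <-> D p /\ forall y, D y -> sqdist x p <= sqdist x y.
Proof.
  split; intros [h1 h2]; (split; [assumption|]); intros y hy;
    apply sqdist_le_norm; auto.
Qed.

(** The minimal value [rho] is the least upper limit of the squared distances to [u]. Since
    [rho + sqdist y c] is below every eventual bound at [y], taking [y = x0] gives the bound by [d],
    and a [y] asymptotically as near as [c] must be [c]. *)
Lemma asymptotic_center (H : HilbertSpace) (C : H -> Prop) (x0 : H)
    (u : nat -> H) (d : R) :
  closed C -> convex_set C -> C x0 ->
  (forall n, sqdist (u n) x0 <= d) ->
  exists c, C c /\ sqdist x0 c <= d /\
    forall y, C y ->
      (forall e, 0 < e -> exists M, forall n, (M <= n)%nat ->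
         sqdist (u n) y <= sqdist (u n) c + e) -> y = c.
Proof.
  intros Cc Cv Cx0 hd.
  assert (d0 : 0 <= d) by (pose proof (sqdist_ge0 (u 0%nat) x0);
    pose proof (hd 0%nat); lra).
  destruct (@uniformly_convex_minimizer H (fun y r => C y /\
    exists M, forall n, (M <= n)%nat -> sqdist (u n) y <= r))
    as [c [rho [hrho [hc hmin]]]].
  - exists x0, d. split; [assumption|]. exists 0%nat. auto.
  - intros y r [_ [M hM]]. pose proof (sqdist_ge0 (u M) y).
    pose proof (hM M (le_n M)). lra.
  - intros y r r' [h1 [M hM]] h. split; [assumption|]. exists M.
    intros n hn. pose proof (hM n hn). lra.
  - intros y y' r r' s [h1 [M hM]] [h3 [M' hM']] hs.
    split; [now apply Cv|]. exists (max M M'). intros n hn.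
    pose proof (hM n ltac:(lia)). pose proof (hM' n ltac:(lia)).
    rewrite sqdist_sym, sqdist_segment, !(sqdist_sym _ (u n)). nra.
  - intros v rho c hrho hv hc e he. split.
    + apply (closed_seq (u := v) Cc); [apply hv | assumption].
    + destruct (sqdist_eventually_le (r := rho + e / 2) (e := e / 2) hc)
        as [M hM]; [lra|lra|].
      destruct (is_lim_seq0_eventually is_lim_seq_inv_S
        (eps := e / 2)) as [M' hM']; [lra|].
      specialize (hM' (max M M') ltac:(lia)).
      rewrite Rabs_pos_eq in hM' by apply Rlt_le, inv_S_pos.
      destruct (hv (max M M')) as [_ [K hK]]. exists K. intros n hn.
      specialize (hM (u n) (max M M') ltac:(lia)). specialize (hK n hn). lra.
  - assert (Cy : C c) by apply (hc 1 Rlt_0_1).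
    exists c. split; [assumption|]. split.
    + assert (h : rho + sqdist x0 c <= d).
      { apply hmin. split; [assumption|]. exists 0%nat. auto. }
      lra.
    + intros y hy h. apply sqdist_eq0, le_of_forall_eps. intros e he.
      destruct (h (e / 2) ltac:(lra)) as [M hM].
      destruct (hc (e / 2) ltac:(lra)) as [_ [M' hM']].
      assert (h' : rho + sqdist y c <= rho + e); [|lra].
      apply hmin. split; [assumption|]. exists (max M M'). intros n hn.
      specialize (hM n ltac:(lia)). specialize (hM' n ltac:(lia)). lra.
Qed.
(** * Fixed points of nonexpansive maps *)

Lemma nonexpansive_sqdist (H : HilbertSpace) (C : H -> Prop) (S : H -> H)
    (x y : H) :
  nonexpansive C S -> C x -> C y -> sqdist (S x) (S y) <= sqdist x y.
Proof. intros [_ h] hx hy. apply sqdist_le_norm. auto. Qed.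

(** Go through the translate [y + (w - z)], as far from [w] as [y] is from [z]. Only the middle
    distance keeps a coefficient near 1; the outer ones are meant to vanish. *)
Lemma sqdist_triangle4 (H : HilbertSpace) (e : R) (x y z w : H) : 0 < e ->
  sqdist x w <=
  (1 + e) * sqdist y z + (1 + / e) * (2 * sqdist x y + 2 * sqdist z w).
Proof.
  intros he.
  pose proof (sqdist_triangle w (plus y (minus w z)) x he) as h.
  assert (e1 : sqdist w (plus y (minus w z)) = sqdist y z)
    by (expand_sqdist; ring).
  assert (e2 : sqdist (plus y (minus w z)) x <=
    2 * sqdist x y + 2 * sqdist z w).
  { pose proof (inner_ge0 (plus (minus x y) (minus w z))) as h2. revert h2.
    expand_sqdist. lra. }
  rewrite e1, (sqdist_sym w) in h.
  assert (0 < / e) by now apply Rinv_0_lt_compat. nra.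
Qed.

(* The asymptotic center plays the role of a weak cluster point in the
   demiclosedness principle. *)
Lemma asymptotic_fixed_point (H : HilbertSpace) (C : H -> Prop) (x0 : H)
    (u : nat -> H) (d : R) :
  closed C -> convex_set C -> C x0 -> (forall n, C (u n)) ->
  (forall n, sqdist (u n) x0 <= d) ->
  exists c, C c /\ sqdist x0 c <= d /\
    forall (S : nat -> H -> H) y, (forall n, nonexpansive C (S n)) ->
      is_lim_seq (fun n => sqdist (S n (u n)) (u n)) 0 ->
      converges (fun n => S n c) y -> y = c.
Proof.
  intros Cc Cv Cx0 hu hd.
  destruct (asymptotic_center Cc Cv Cx0 hd) as [c [hc [hc0 uniq]]].
  exists c. split; [assumption|]. split; [assumption|].
  intros S y hS hSu hy. apply uniq.
  { apply (closed_seq (u := fun n => S n c) Cc); [|assumption].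
    intros n. now apply (hS n). }
  intros e he.
  assert (d0 : 0 <= d) by (pose proof (sqdist_ge0 x0 c); lra).
  (* Up to vanishing terms, |u n - y| is |S n (u n) - S n c|, which is at most |u n - c|. The square
     of the latter is at most [4 * d], so the weight [t] costs at most [e / 2]. *)
  set (t := e / (2 * (4 * d + 1))).
  assert (ht : 0 < t) by (unfold t; apply Rdiv_lt_0_compat; lra).
  assert (et : t * (2 * (4 * d + 1)) = e) by (unfold t; field; lra).
  assert (ht' : 0 < / t) by now apply Rinv_0_lt_compat.
  assert (hq : 0 < e / 2 / (1 + / t)) by (apply Rdiv_lt_0_compat; lra).
  apply converges_sqdist in hy.
  destruct (is_lim_seq0_eventually (is_lim_seq_lincomb0 2 2 hSu hy) hq)
    as [M hM].
  exists M. intros n hn. specialize (hM n hn).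
  apply Rabs_def2 in hM. destruct hM as [hM _].
  pose proof (sqdist_triangle4 (u n) (S n (u n)) (S n c) y ht) as h.
  rewrite (sqdist_sym (u n) (S n (u n))) in h.
  pose proof (nonexpansive_sqdist (hS n) (hu n) hc).
  pose proof (sqdist_triangle2 (u n) x0 c). pose proof (hd n).
  assert ((1 + / t) * (2 * sqdist (S n (u n)) (u n) +
     2 * sqdist (S n c) y) <= e / 2).
  { apply Rmult_lt_compat_l with (r := 1 + / t) in hM; [|lra].
    replace ((1 + / t) * (e / 2 / (1 + / t))) with (e / 2) in hM
      by (field; split; nra). lra. }
  clearbody t. nra.
Qed.

(** For [z] on the segment, [sqdist_segment] writes |z - w|^2 through |x - w|^2 and |y - w|^2. Both
    are no larger at [w = S z] than at [w = z], where the result is 0. *)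
Lemma fix_convex (H : HilbertSpace) (C : H -> Prop) (S : H -> H) :
  convex_set C -> nonexpansive C S -> convex_set (Fix C S).
Proof.
  intros Cv hS x y s [hx ex] [hy ey] hs.
  change (Fix C S (segment s x y)).
  assert (hz : C (segment s x y)) by now apply Cv.
  split; [assumption|]. apply sqdist_eq0.
  rewrite sqdist_sym, sqdist_segment.
  pose proof (nonexpansive_sqdist hS hx hz) as h1.
  pose proof (nonexpansive_sqdist hS hy hz) as h2.
  rewrite ex in h1. rewrite ey in h2.
  rewrite (sqdist_sym x (segment _ _ _)), sqdist_segment, sqdist_refl in h1.
  rewrite (sqdist_sym y (segment _ _ _)), sqdist_segment, sqdist_refl in h2.
  rewrite (sqdist_sym y x) in h1.
  nra.
Qed.

Lemma fix_closed (H : HilbertSpace) (C : H -> Prop) (S : H -> H)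
    (u : nat -> H) (l : H) :
  closed C -> nonexpansive C S -> (forall n, Fix C S (u n)) ->
  converges u l -> Fix C S l.
Proof.
  intros Cc hS hu hl.
  assert (Cl : C l) by (apply (closed_seq Cc (u := u)); [apply hu|assumption]).
  split; [assumption|]. apply sqdist_eq0, le_of_forall_eps. intros e he.
  apply converges_sqdist in hl.
  destruct (is_lim_seq0_eventually hl (eps := e / 4)) as [M hM]; [lra|].
  specialize (hM M (le_n M)). rewrite Rabs_pos_eq in hM by apply sqdist_ge0.
  destruct (hu M) as [hC hfix].
  pose proof (nonexpansive_sqdist hS hC Cl) as h. rewrite hfix in h.
  pose proof (sqdist_triangle2 (S l) (u M) l) as h2.
  rewrite (sqdist_sym (S l) (u M)) in h2. lra.
Qed.

(** * The two algorithms for cutters *)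

Lemma cauchy_schwarz (H : HilbertSpace) (x y : H) :
  Rabs (inner x y) <= norm x * norm y.
Proof.
  assert (hxy : 0 <= norm x * norm y)
    by (apply Rmult_le_pos; apply norm_ge_0).
  apply Rsqr_incr_0_var; [|assumption]. unfold Rsqr.
  rewrite <- Rabs_mult, Rabs_pos_eq by nra.
  replace (norm x * norm y * (norm x * norm y)) with (inner x x * inner y y)
    by (rewrite !inner_norm; ring).
  destruct (Rle_lt_dec (inner y y) 0) as [h|h].
  - rewrite (inner_eq0 h), !inner_zero_r. lra.
  - pose proof (inner_ge0 (minus (scal (inner y y) x) (scal (inner x y) y)))
      as h2. revert h2. expand_inner. intros h2.
    apply Rmult_le_reg_l with (inner y y); [assumption|]. nra.
Qed.

Lemma inner_continuous (H : HilbertSpace) (v l : H) :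
  continuous (fun x => inner x v) l.
Proof.
  apply filterlim_locally. intros eps.
  assert (hv : 0 < norm v + 1) by (pose proof (norm_ge_0 v); lra).
  assert (he : 0 < eps / (norm v + 1)).
  { apply Rdiv_lt_0_compat; [apply cond_pos | assumption]. }
  eapply filter_imp; [|exact (locally_ball_norm l (mkposreal _ he))].
  intros x hx. unfold ball_norm in hx. simpl in hx.
  change (Rabs (inner x v - inner l v) < eps).
  rewrite <- inner_minus_l.
  eapply Rle_lt_trans; [apply cauchy_schwarz|].
  apply Rmult_lt_compat_r with (r := norm v + 1) in hx; [|assumption].
  replace (eps / (norm v + 1) * (norm v + 1)) with (pos eps) in hx
    by (field; lra).
  pose proof (norm_ge_0 (minus x l)). pose proof (norm_ge_0 v).
  eapply Rle_lt_trans; [|exact hx].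
  apply Rmult_le_compat_l; [apply norm_ge_0 | lra].
Qed.

Lemma halfspace_convex (H : HilbertSpace) (D : H -> Prop) (x y : H) :
  convex_set D -> convex_set (halfspace D x y).
Proof.
  intros Dv z w s [hz hz'] [hw hw'] hs. split; [now apply Dv|].
  revert hz' hw'. expand_inner. intros hz' hw'. nra.
Qed.

(** Membership in [D] is asked of the limit, so that the lemma serves both algorithms, with [D]
    equal to [C] or to [whole]. *)
Lemma halfspace_closed (H : HilbertSpace) (D : H -> Prop) (x y : H)
    (u : nat -> H) (l : H) :
  D l -> (forall n, halfspace (@whole H) x y (u n)) -> converges u l ->
  halfspace D x y l.
Proof.
  intros Dl hu hl. split; [assumption|].
  rewrite inner_minus_l. apply Rle_minus.
  refine (is_lim_seq_le (fun n => inner (u n) (minus x y))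
    (fun _ => inner y (minus x y)) (inner l (minus x y))
    (inner y (minus x y)) _ _ (is_lim_seq_const _)).
  - intros n. destruct (hu n) as [_ h]. rewrite inner_minus_l in h. lra.
  - exact (filterlim_comp _ _ _ u (fun z => inner z (minus x y)) _ _ _ hl
      (@inner_continuous H (minus x y) l)).
Qed.

(** Stands in for the condition that all weak cluster points of [u] lie in [F]: it asks for one
    point of [F] in the ball about [x0] that contains the sequence. *)
Definition coherent (H : HilbertSpace) (C F : H -> Prop)
    (T : nat -> H -> H) (x0 : H) : Prop :=
  forall u d, (forall n, C (u n)) -> (forall n, sqdist (u n) x0 <= d) ->
    is_lim_seq (fun n => sqdist (T n (u n)) (u n)) 0 ->
    exists c, F c /\ sqdist x0 c <= d.

(** When [F] is the fixed point set, such maps are also called firmly quasi-nonexpansive. *)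
Definition cutter (H : HilbertSpace) (C F : H -> Prop) (T : H -> H) : Prop :=
  self_map C T /\
  forall x z, C x -> F z -> inner (minus z (T x)) (minus x (T x)) <= 0.

Lemma sqdist_obtuse (H : HilbertSpace) (x y z : H) :
  inner (minus z y) (minus x y) <= 0 <->
  sqdist y x + sqdist z y <= sqdist z x.
Proof. expand_sqdist. split; intros; lra. Qed.

(* Since [|x n - x0|] increases and [p] lies in the half-space of [x0] and
   [x n], it is enough to see that the limit of [|x n - x0|] is at least
   [|p - x0|], which a point of [F] near the [x n] provides. *)
Lemma outer_approximation_converges (H : HilbertSpace) (C F : H -> Prop)
    (T : nat -> H -> H) (x0 p : H) (x : nat -> H) :
  coherent C F T x0 -> (forall n, C (x n)) ->
  (forall z, F z -> sqdist x0 p <= sqdist x0 z) ->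
  (forall n, inner (minus p (x n)) (minus x0 (x n)) <= 0) ->
  (forall n, inner (minus (x (S n)) (x n)) (minus x0 (x n)) <= 0) ->
  (forall n, inner (minus (x (S n)) (T n (x n)))
     (minus (x n) (T n (x n))) <= 0) ->
  converges x p.
Proof.
  intros hcoh Cx pmin hp hx hT.
  assert (incr : forall n, sqdist (x n) x0 <= sqdist (x (S n)) x0).
  { intros n. specialize (hx n). apply sqdist_obtuse in hx.
    pose proof (sqdist_ge0 (x (S n)) (x n)). lra. }
  assert (bnd : forall n, sqdist (x n) x0 <= sqdist p x0).
  { intros n. specialize (hp n). apply sqdist_obtuse in hp.
    pose proof (sqdist_ge0 p (x n)). lra. }
  destruct (ex_finite_lim_seq_incr _ _ incr bnd) as [d hd].
  assert (le_d : forall n, sqdist (x n) x0 <= d).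
  { exact (is_lim_seq_incr_compare _ _ hd incr). }
  destruct (hcoh x d Cx le_d) as [c [Fc hc]].
  (* The two angle conditions chain: |T n (x n) - x n|^2 is at most |x (n+1) - x n|^2, itself at
     most the increment of |x n - x0|^2, a convergent sequence. *)
  { apply is_lim_seq_squeeze0
      with (fun n => 1 * sqdist (x (S n)) x0 + (-1) * sqdist (x n) x0).
    - intros n. split; [apply sqdist_ge0|].
      specialize (hx n). apply sqdist_obtuse in hx.
      specialize (hT n). apply sqdist_obtuse in hT.
      pose proof (sqdist_ge0 (x (S n)) (T n (x n))). lra.
    - replace 0 with (1 * d + (-1) * d) by ring.
      apply is_lim_seq_plus'.
      + apply (is_lim_seq_scal_l (fun n => sqdist (x (S n)) x0) 1 d).
        now apply (is_lim_seq_incr_1 (fun n => sqdist (x n) x0)).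
      + now apply (is_lim_seq_scal_l (fun n => sqdist (x n) x0) (-1) d). }
  apply converges_sqdist.
  apply is_lim_seq_squeeze0 with (fun n => d - sqdist (x n) x0).
  - intros n. split; [apply sqdist_ge0|].
    specialize (hp n). apply sqdist_obtuse in hp.
    specialize (pmin c Fc). rewrite (sqdist_sym x0 p) in pmin.
    rewrite (sqdist_sym (x n) p). lra.
  - replace 0 with (d - d) by ring.
    apply is_lim_seq_minus'; [apply is_lim_seq_const | assumption].
Qed.

Lemma haugazeau_converges (H : HilbertSpace) (C F : H -> Prop)
    (T : nat -> H -> H) (x0 p : H) (x : nat -> H) :
  convex_set C -> C x0 -> (forall z, F z -> C z) ->
  (forall n, cutter C F (T n)) -> coherent C F T x0 ->
  F p -> (forall z, F z -> sqdist x0 p <= sqdist x0 z) ->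
  haugazeau C T x0 x -> converges x p.
Proof.
  intros Cv Cx0 FC hT hcoh Fp pmin [e0 hx].
  assert (Cx : forall n, C (x n)).
  { intros [|n]; [now rewrite e0|]. apply (hx n). }
  apply (outer_approximation_converges hcoh Cx pmin).
  (* For [n = 0] the half-space is the whole space. Afterwards [p] lies in both half-spaces of step
     [n], and projecting [x0] onto their intersection puts [p] in the next one. *)
  - intros n. induction n as [|n IH].
    + rewrite e0. expand_inner. lra.
    + destruct (proj1 (is_proj_sqdist _ _ _) (hx n)) as [h1 h2].
      refine (projection_inner _ h1 _ h2).
      * intros y z s [hy hy'] [hz hz'] hs.
        split; apply halfspace_convex; assumption.
      * split; split; auto. now apply (hT n).
  - intros n. apply (hx n).
  - intros n. apply (hx n).
Qed.

Lemma shrinking_set_sub (H : HilbertSpace) (C : H -> Prop)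
    (T : nat -> H -> H) (x : nat -> H) (n : nat) (z : H) :
  shrinking_set C T x n z -> C z.
Proof. induction n as [|n IH]; [easy|]. intros [h _]. auto. Qed.

Lemma shrinking_set_convex (H : HilbertSpace) (C : H -> Prop)
    (T : nat -> H -> H) (x : nat -> H) (n : nat) :
  convex_set C -> convex_set (shrinking_set C T x n).
Proof.
  intros Cv. induction n as [|n IH]; [assumption|].
  intros y z s [hy hy'] [hz hz'] hs. split; [now apply IH|].
  apply halfspace_convex; easy.
Qed.

Lemma shrinking_set_closed (H : HilbertSpace) (C : H -> Prop)
    (T : nat -> H -> H) (x : nat -> H) (n : nat) (u : nat -> H) (l : H) :
  closed C -> (forall m, shrinking_set C T x n (u m)) -> converges u l ->
  shrinking_set C T x n l.
Proof.
  intros Cc hu hl. induction n as [|n IH].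
  - exact (closed_seq Cc hu hl).
  - split; [apply IH; intros m; apply (hu m)|].
    apply (halfspace_closed (u := u)); [easy | intros m; apply (hu m)|easy].
Qed.

Lemma shrinking_converges (H : HilbertSpace) (C F : H -> Prop)
    (T : nat -> H -> H) (x0 p : H) (x : nat -> H) :
  convex_set C -> C x0 -> (forall z, F z -> C z) ->
  (forall n, cutter C F (T n)) -> coherent C F T x0 ->
  F p -> (forall z, F z -> sqdist x0 p <= sqdist x0 z) ->
  shrinking C T x0 x -> converges x p.
Proof.
  intros Cv Cx0 FC hT hcoh Fp pmin [e0 hx].
  assert (Cx : forall n, C (x n)).
  { intros [|n]; [now rewrite e0|].
    exact (shrinking_set_sub (proj1 (hx n))). }
  assert (pS : forall n, shrinking_set C T x n p).
  { induction n as [|n IH]; [now apply FC|]. split; [assumption|].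
    split; [easy|]. now apply (hT n). }
  (* Here [x n] projects [x0] onto the whole [n]-th set. As the sets decrease, this one fact applies
     to [p] and to [x (S n)]. *)
  assert (obt : forall n z, shrinking_set C T x n z ->
    inner (minus z (x n)) (minus x0 (x n)) <= 0).
  { intros [|n] z hz.
    - rewrite e0. expand_inner. lra.
    - destruct (proj1 (is_proj_sqdist _ _ _) (hx n)) as [h1 h2].
      exact (projection_inner (shrinking_set_convex Cv) h1 hz h2). }
  apply (outer_approximation_converges hcoh Cx pmin).
  - auto.
  - intros n. apply obt. apply (hx n).
  - intros n. apply (hx n).
Qed.

(** * Existence of infinite runs *)

Definition some_projection (H : HilbertSpace) (D : H -> Prop) (x : H) : H :=
  epsilon (inhabits zero) (is_proj D x).

Lemma some_projection_spec (H : HilbertSpace) (D : H -> Prop) (x : H) :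
  (exists y, D y) -> convex_set D ->
  (forall u l, (forall n, D (u n)) -> converges u l -> D l) ->
  is_proj D x (some_projection D x).
Proof.
  intros ne cvx clos. apply (epsilon_spec (inhabits zero) (is_proj D x)).
  destruct (projection_exists x ne cvx clos) as [p [hp hmin]].
  exists p. apply is_proj_sqdist. split; [assumption|]. intros y hy.
  specialize (hmin y hy). pose proof (sqdist_ge0 y p). lra.
Qed.

(** [some_projection] is total, with an arbitrary value when there is no projection, so the
    recursion precedes the proof in [haugazeau_exists] that the projections exist. *)
Fixpoint haugazeau_run (H : HilbertSpace) (C : H -> Prop)
    (T : nat -> H -> H) (x0 : H) (n : nat) : H :=
  match n with
  | O => x0
  | S m =>
      let y := haugazeau_run C T x0 m in
      some_projection
        (fun w => halfspace C x0 y w /\ halfspace C y (T m y) w) x0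
  end.

(** The nonempty [F] stays in both half-spaces: in the second because [T n] is a cutter, in the
    first by the angle property of the preceding projection. *)
Lemma haugazeau_exists (H : HilbertSpace) (C F : H -> Prop)
    (T : nat -> H -> H) (x0 : H) :
  closed C -> convex_set C -> C x0 -> (forall z, F z -> C z) ->
  (exists z, F z) -> (forall n, cutter C F (T n)) ->
  exists x, haugazeau C T x0 x.
Proof.
  intros Cc Cv Cx0 FC [z0 Fz0] hT. exists (haugazeau_run C T x0).
  split; [reflexivity|].
  set (x := haugazeau_run C T x0).
  set (D := fun n w => halfspace C x0 (x n) w /\
    halfspace C (x n) (T n (x n)) w).
  assert (Dv : forall n, convex_set (D n)).
  { intros n y z s [hy hy'] [hz hz'] hs.
    split; apply halfspace_convex; assumption. }
  assert (step : forall n, C (x n) ->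
    (forall z, F z -> inner (minus z (x n)) (minus x0 (x n)) <= 0) ->
    (forall z, F z -> D n z) /\ is_proj (D n) x0 (x (S n))).
  { intros n Cx hF.
    assert (FD : forall z, F z -> D n z).
    { intros z hz. split; split; auto. now apply (hT n). }
    split; [assumption|].
    apply some_projection_spec; [now exists z0; apply FD | apply Dv |].
    intros u l hu hl.
    assert (Cl : C l) by (apply (closed_seq Cc (u := u));
      [intros n'; apply (hu n') | assumption]).
    split; (apply (halfspace_closed (u := u)); [easy | | easy]); intros k;
      (split; [easy | apply (hu k)]). }
  assert (inv : forall n, C (x n) /\
    forall z, F z -> inner (minus z (x n)) (minus x0 (x n)) <= 0).
  { induction n as [|n [Cx hF]].
    - split; [assumption|]. intros z _. change (x 0%nat) with x0.
      expand_inner. lra.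
    - destruct (step n Cx hF) as [FD hproj].
      apply is_proj_sqdist in hproj. destruct hproj as [h1 h2].
      split; [apply h1|]. intros z hz.
      exact (projection_inner (Dv n) h1 (FD z hz) h2). }
  intros n. exact (proj2 (step n (proj1 (inv n)) (proj2 (inv n)))).
Qed.

(** [shrinking_set] takes the sequence of iterates as an argument, so the recursion that builds this
    sequence carries the current set along. *)
Fixpoint shrinking_run (H : HilbertSpace) (C : H -> Prop)
    (T : nat -> H -> H) (x0 : H) (n : nat) : (H -> Prop) * H :=
  match n with
  | O => (C, x0)
  | S m =>
      let (D, y) := shrinking_run C T x0 m in
      let D' := fun z => D z /\ halfspace (@whole H) y (T m y) z in
      (D', some_projection D' x0)
  end.

Lemma shrinking_run_set (H : HilbertSpace) (C : H -> Prop)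
    (T : nat -> H -> H) (x0 : H) (n : nat) :
  fst (shrinking_run C T x0 n) =
  shrinking_set C T (fun m => snd (shrinking_run C T x0 m)) n.
Proof.
  induction n as [|n IH]; [reflexivity|]. simpl. rewrite <- IH.
  now destruct (shrinking_run C T x0 n).
Qed.

Lemma shrinking_exists (H : HilbertSpace) (C F : H -> Prop)
    (T : nat -> H -> H) (x0 : H) :
  closed C -> convex_set C -> C x0 -> (forall z, F z -> C z) ->
  (exists z, F z) -> (forall n, cutter C F (T n)) ->
  exists x, shrinking C T x0 x.
Proof.
  intros Cc Cv Cx0 FC [z0 Fz0] hT.
  set (x := fun n => snd (shrinking_run C T x0 n)).
  exists x. split; [reflexivity|].
  assert (ex : forall n, x (S n) =
    some_projection (shrinking_set C T x (S n)) x0).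
  { intros n.
    transitivity (some_projection (fst (shrinking_run C T x0 (S n))) x0);
      [|now rewrite shrinking_run_set].
    unfold x. simpl. now destruct (shrinking_run C T x0 n). }
  assert (step : forall n, (forall z, F z -> shrinking_set C T x n z) ->
    C (x n) -> (forall z, F z -> shrinking_set C T x (S n) z) /\
    is_proj (shrinking_set C T x (S n)) x0 (x (S n))).
  { intros n hF Cx.
    assert (FS : forall z, F z -> shrinking_set C T x (S n) z).
    { intros z hz. split; [auto|]. split; [easy|]. now apply (hT n). }
    split; [assumption|]. rewrite ex.
    apply some_projection_spec.
    - exists z0. auto.
    - now apply shrinking_set_convex.
    - intros u l. now apply shrinking_set_closed. }
  assert (inv : forall n, (forall z, F z -> shrinking_set C T x n z) /\
    C (x n)).
  { induction n as [|n [hF Cx]]; [now split|].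
    destruct (step n hF Cx) as [FS hproj]. split; [assumption|].
    exact (shrinking_set_sub (proj1 hproj)). }
  intros n. exact (proj2 (step n (proj1 (inv n)) (proj2 (inv n)))).
Qed.
(** * Relaxed compositions *)

Lemma sqdist_segment2 (H : HilbertSpace) (s : R) (x y x' y' : H) :
  0 <= s <= 1 ->
  sqdist (segment s x y) (segment s x' y') <=
  s * sqdist x x' + (1 - s) * sqdist y y'.
Proof.
  intros hs.
  assert (e : sqdist (segment s x y) (segment s x' y') =
    s * sqdist x x' + (1 - s) * sqdist y y' -
    s * (1 - s) * sqdist (minus x x') (minus y y')).
  { unfold segment. expand_sqdist. ring. }
  pose proof (sqdist_ge0 (minus x x') (minus y y')).
  assert (0 <= s * (1 - s)) by nra. nra.
Qed.

Lemma segment_refl (H : HilbertSpace) (s : R) (x : H) : segment s x x = x.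
Proof. apply inner_ext. intros z. unfold segment. expand_inner. ring. Qed.

Lemma Gamma_from_nonexpansive (H : HilbertSpace) (C : H -> Prop)
    (alpha : nat -> nat -> R) (T : nat -> nat -> H -> H) (k j n : nat) :
  convex_set C ->
  (forall i, (j <= i < j + k)%nat ->
     nonexpansive C (T i n) /\ 0 <= alpha i n <= 1) ->
  nonexpansive C (Gamma_from alpha T k j n).
Proof.
  intros Cv. revert j. induction k as [|k IH]; intros j hT.
  - split; [now intros x|]. intros x y _ _. apply Rle_refl.
  - destruct (hT j ltac:(lia)) as [hTj ha].
    assert (hG : nonexpansive C (Gamma_from alpha T k (S j) n)).
    { apply IH. intros i hi. apply hT. lia. }
    split.
    + intros x hx. apply Cv; [assumption | | assumption].
      now apply hTj, hG.
    + intros x y hx hy. apply sqdist_le_norm. cbn [Gamma_from].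
      change (sqdist
        (segment (alpha j n) x (T j n (Gamma_from alpha T k (S j) n x)))
        (segment (alpha j n) y (T j n (Gamma_from alpha T k (S j) n y)))
        <= sqdist x y).
      eapply Rle_trans; [now apply sqdist_segment2|].
      pose proof (nonexpansive_sqdist hTj (proj1 hG x hx) (proj1 hG y hy)).
      pose proof (nonexpansive_sqdist hG hx hy). nra.
Qed.

Lemma Gamma_from_fixed (H : HilbertSpace) (alpha : nat -> nat -> R)
    (T : nat -> nat -> H -> H) (k j n : nat) (z : H) :
  (forall i, (j <= i < j + k)%nat -> T i n z = z) ->
  Gamma_from alpha T k j n z = z.
Proof.
  revert j. induction k as [|k IH]; intros j hT; [reflexivity|].
  cbn [Gamma_from]. rewrite IH, hT by (lia || (intros; apply hT; lia)).
  apply segment_refl.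
Qed.

Lemma averaged_segment (H : HilbertSpace) (N : nat)
    (alpha : nat -> nat -> R) (T : nat -> nat -> H -> H) (n : nat) (x : H) :
  averaged_map N alpha T n x = segment (/ 2) (Gamma N alpha T 1 n x) x.
Proof.
  apply inner_ext. intros z. unfold averaged_map, segment.
  expand_inner. field.
Qed.

(** At the midpoint of [x] and [S x] the inner product equals (|S x - z|^2 - |x - z|^2) / 4. *)
Lemma averaged_cutter (H : HilbertSpace) (C F : H -> Prop) (S : H -> H) :
  convex_set C -> (forall z, F z -> Fix C S z) -> nonexpansive C S ->
  cutter C F (fun x => segment (/ 2) (S x) x).
Proof.
  intros Cv hF hS. split.
  - intros x hx. apply Cv; [now apply hS | assumption | lra].
  - intros x z hx hz. destruct (hF z hz) as [Cz ez].
    pose proof (nonexpansive_sqdist hS hx Cz) as h. rewrite ez in h.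
    revert h. unfold segment. expand_sqdist. lra.
Qed.

Lemma is_lim_seq0_scal_l (c : R) (u : nat -> R) :
  is_lim_seq u 0 -> is_lim_seq (fun n => c * u n) 0.
Proof.
  intros hu. replace 0 with (c * 0) by ring.
  exact (is_lim_seq_scal_l u c 0 hu).
Qed.

Lemma sqdist_gap_vanishes (H : HilbertSpace) (u w : nat -> H) (z : H)
    (B : R) :
  (forall n, sqdist (w n) z <= sqdist (u n) z <= B) ->
  is_lim_seq (fun n => sqdist (w n) (u n)) 0 ->
  is_lim_seq (fun n => sqdist (u n) z - sqdist (w n) z) 0.
Proof.
  intros hb hw. apply is_lim_seq_spec. intros eps. pose proof (cond_pos eps).
  assert (hB : 0 <= B).
  { pose proof (hb 0%nat). pose proof (sqdist_ge0 (u 0%nat) z). lra. }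
  set (t := eps / (2 * (B + 1))).
  assert (ht : 0 < t) by (unfold t; apply Rdiv_lt_0_compat; lra).
  assert (et : t * (2 * (B + 1)) = eps) by (unfold t; field; lra).
  assert (ht' : 0 < / t) by now apply Rinv_0_lt_compat.
  destruct (is_lim_seq0_eventually (is_lim_seq0_scal_l (1 + / t) hw)
    (eps := eps / 2)) as [M hM]; [lra|].
  exists M. intros n hn. specialize (hM n hn). apply Rabs_def2 in hM.
  destruct (hb n). rewrite Rminus_0_r, Rabs_pos_eq by lra.
  (* Called with [/ t], so that the small weight [t] falls on the bounded term and the large one on
     the vanishing term. *)
  pose proof (sqdist_triangle (u n) (w n) z ht') as h.
  rewrite Rinv_inv, (sqdist_sym (u n) (w n)) in h.
  clearbody t. nra.
Qed.

(** The decrease of the squared distance to [z] contains [s * (1 - s) * sqdist u v], and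
    [s * (1 - s)] is at least [a * (1 - b)]. *)
Lemma relaxation_step (H : HilbertSpace) (s a b : R) (u v z : H) :
  0 < a -> b < 1 -> a < s < b -> sqdist v z <= sqdist u z ->
  0 <= sqdist v u <=
    / (a * (1 - b)) * (sqdist u z - sqdist (segment s u v) z) /\
  sqdist (segment s u v) u <= sqdist v u.
Proof.
  intros ha hb hs h. pose proof (sqdist_ge0 v u).
  assert (0 < a * (1 - b)) by nra.
  rewrite !sqdist_segment, sqdist_refl, (sqdist_sym u v).
  assert ((1 - s) * (1 - s) <= 1) by nra.
  repeat split; [assumption | | nra].
  apply Rmult_le_reg_l with (a * (1 - b)); [assumption|].
  rewrite <- Rmult_assoc, Rinv_r, Rmult_1_l by lra.
  assert (0 <= (1 - s) * (sqdist u z - sqdist v z)) by nra.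
  assert (a * (1 - b) <= s * (1 - s)) by nra. nra.
Qed.

(** Hands a vanishing decrease on to the inner composition: [y] is the inner point and [v] its
    image. Only the factor [1 - s] is lost, so [s = 0] is allowed. *)
Lemma relaxation_gap (H : HilbertSpace) (s b : R) (u v y z : H) :
  b < 1 -> 0 <= s < b -> sqdist v z <= sqdist y z <= sqdist u z ->
  0 <= sqdist u z - sqdist y z <=
    / (1 - b) * (sqdist u z - sqdist (segment s u v) z).
Proof.
  intros hb hs h. split; [lra|].
  apply Rmult_le_reg_l with (1 - b); [lra|].
  rewrite <- Rmult_assoc, Rinv_r, Rmult_1_l, sqdist_segment by lra.
  pose proof (sqdist_ge0 u v).
  assert (0 <= s * (1 - s) * sqdist u v) by
    (apply Rmult_le_pos; [nra|assumption]). nra.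
Qed.

Lemma sqdist_displacement (H : HilbertSpace) (C : H -> Prop) (S : H -> H)
    (x y : H) :
  nonexpansive C S -> C x -> C y ->
  sqdist (S x) x <= 2 * sqdist y x + 2 * sqdist (S y) x.
Proof.
  intros hS hx hy. pose proof (nonexpansive_sqdist hS hx hy).
  rewrite (sqdist_sym y x).
  pose proof (sqdist_triangle2 (S x) (S y) x). lra.
Qed.

(** The hypothesis is a vanishing decrease of the distance to [z] rather than a vanishing
    displacement, because that form passes from level [j] to level [j + 1] by [relaxation_gap]. *)
Lemma Gamma_from_components (H : HilbertSpace) (C : H -> Prop)
    (alpha : nat -> nat -> R) (T : nat -> nat -> H -> H) (a b : R)
    (u : nat -> H) (z : H) (k j : nat) :
  convex_set C -> 0 < a -> b < 1 ->
  (forall i n, (j <= i < j + k)%nat -> nonexpansive C (T i n)) ->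
  (forall i n, (j <= i < j + k)%nat -> a < alpha i n < b) ->
  (forall i n, (j <= i < j + k)%nat -> T i n z = z) ->
  C z -> (forall n, C (u n)) ->
  is_lim_seq (fun n => sqdist (u n) z -
    sqdist (Gamma_from alpha T k j n (u n)) z) 0 ->
  is_lim_seq (fun n => sqdist (Gamma_from alpha T k j n (u n)) (u n)) 0 /\
  forall i, (j <= i < j + k)%nat ->
    is_lim_seq (fun n => sqdist (T i n (u n)) (u n)) 0.
Proof.
  intros Cv ha hb hT. intros halpha hz Cz Cu. revert j hT halpha hz.
  induction k as [|k IH]; intros j hT halpha hz hlim.
  { split; [|intros; lia]. eapply is_lim_seq_ext; [|apply is_lim_seq_const].
    intros n. cbn. now rewrite sqdist_refl. }
  set (y := fun n => Gamma_from alpha T k (S j) n (u n)).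
  assert (hG : forall n, nonexpansive C (Gamma_from alpha T k (S j) n)).
  { intros n. apply Gamma_from_nonexpansive; [assumption|]. intros i hi.
    split; [apply hT; lia|]. specialize (halpha i n ltac:(lia)). lra. }
  assert (Cy : forall n, C (y n)) by (intros n; now apply hG).
  assert (hyz : forall n, sqdist (y n) z <= sqdist (u n) z).
  { intros n. pose proof (nonexpansive_sqdist (hG n) (Cu n) Cz) as h.
    rewrite (@Gamma_from_fixed H alpha T k (S j) n z) in h; [exact h|].
    intros i hi. apply hz. lia. }
  assert (hTy : forall n, sqdist (T j n (y n)) z <= sqdist (y n) z).
  { intros n.
    pose proof (nonexpansive_sqdist (hT j n ltac:(lia)) (Cy n) Cz) as h.
    now rewrite hz in h by lia. }
  set (w := fun n => Gamma_from alpha T (S k) j n (u n)).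
  change (is_lim_seq (fun n => sqdist (u n) z - sqdist (w n) z) 0) in hlim.
  assert (ew : forall n, w n = segment (alpha j n) (u n) (T j n (y n)))
    by reflexivity.
  assert (hsy : is_lim_seq (fun n => sqdist (T j n (y n)) (u n)) 0).
  { apply is_lim_seq_squeeze0 with (2 := is_lim_seq0_scal_l
      (/ (a * (1 - b))) hlim). intros n. rewrite ew.
    apply relaxation_step; auto; [apply halpha; lia|].
    pose proof (hyz n). pose proof (hTy n). lra. }
  destruct (IH (S j)) as [hy hTi].
  { intros i n hi. apply hT. lia. }
  { intros i n hi. apply halpha. lia. }
  { intros i n hi. apply hz. lia. }
  { apply is_lim_seq_squeeze0 with (2 := is_lim_seq0_scal_l
      (/ (1 - b)) hlim). intros n. rewrite ew.
    apply relaxation_gap; [assumption | | exact (conj (hTy n) (hyz n))].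
    specialize (halpha j n ltac:(lia)). lra. }
  split.
  - apply is_lim_seq_squeeze0 with (2 := hsy). intros n.
    split; [apply sqdist_ge0|]. change (sqdist (w n) (u n) <=
      sqdist (T j n (y n)) (u n)). rewrite ew.
    apply (relaxation_step (a := a) (b := b) (z := z)); auto;
      [apply halpha; lia|].
    pose proof (hyz n). pose proof (hTy n). lra.
  - intros i hi. destruct (Nat.eq_dec i j) as [->|hij]; [|apply hTi; lia].
    apply is_lim_seq_squeeze0 with (2 := is_lim_seq_lincomb0 2 2 hy hsy).
    intros n. split; [apply sqdist_ge0|].
    apply (sqdist_displacement (C := C)); auto.
Qed.

(** The first relaxation may be 0, so level 1 is handled through |w - u|^2 = (1 - alpha^(1))^2 |v -
    u|^2, where [v] is the image under [T 1 n]. The vanishing displacement, with [B], becomes a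
    vanishing decrease that starts the induction at level 2. *)
Lemma Gamma_components (H : HilbertSpace) (C : H -> Prop) (N : nat)
    (alpha : nat -> nat -> R) (T : nat -> nat -> H -> H) (a b B : R)
    (u : nat -> H) (z : H) :
  convex_set C -> (1 <= N)%nat -> 0 < a -> b < 1 ->
  (forall i n, (1 <= i <= N)%nat -> nonexpansive C (T i n)) ->
  (forall i n, (2 <= i <= N)%nat -> a < alpha i n < b) ->
  (forall n, 0 <= alpha 1%nat n < b) ->
  (forall i n, (1 <= i <= N)%nat -> T i n z = z) ->
  C z -> (forall n, C (u n)) -> (forall n, sqdist (u n) z <= B) ->
  is_lim_seq (fun n => sqdist (Gamma N alpha T 1 n (u n)) (u n)) 0 ->
  forall i, (1 <= i <= N)%nat ->
    is_lim_seq (fun n => sqdist (T i n (u n)) (u n)) 0.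
Proof.
  intros Cv hN ha hb hT halpha halpha1 hz Cz Cu hB hlim.
  destruct N as [|k]; [lia|].
  set (y := fun n => Gamma_from alpha T k 2 n (u n)).
  assert (hG : forall n, nonexpansive C (Gamma_from alpha T k 2 n)).
  { intros n. apply Gamma_from_nonexpansive; [assumption|]. intros i hi.
    split; [apply hT; lia|]. specialize (halpha i n ltac:(lia)). lra. }
  assert (Cy : forall n, C (y n)) by (intros n; now apply hG).
  assert (hyz : forall n, sqdist (y n) z <= sqdist (u n) z).
  { intros n. pose proof (nonexpansive_sqdist (hG n) (Cu n) Cz) as h.
    rewrite (@Gamma_from_fixed H alpha T k 2 n z) in h; [exact h|].
    intros i hi. apply hz. lia. }
  assert (hTy : forall n, sqdist (T 1%nat n (y n)) z <= sqdist (y n) z).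
  { intros n.
    pose proof (nonexpansive_sqdist (hT 1%nat n ltac:(lia)) (Cy n) Cz) as h.
    now rewrite hz in h by lia. }
  set (w := fun n => segment (alpha 1%nat n) (u n) (T 1%nat n (y n))).
  assert (hw : is_lim_seq (fun n => sqdist (w n) (u n)) 0).
  { eapply is_lim_seq_ext; [|exact hlim]. intros n. unfold Gamma.
    now replace (S k + 1 - 1)%nat with (S k) by lia. }
  assert (hsy : is_lim_seq (fun n => sqdist (T 1%nat n (y n)) (u n)) 0).
  { apply is_lim_seq_squeeze0 with (2 := is_lim_seq0_scal_l
      (/ ((1 - b) * (1 - b))) hw). intros n. split; [apply sqdist_ge0|].
    specialize (halpha1 n).
    apply Rmult_le_reg_l with ((1 - b) * (1 - b)); [nra|].
    rewrite <- Rmult_assoc, Rinv_r, Rmult_1_l by nra. unfold w.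
    rewrite sqdist_segment, sqdist_refl, (sqdist_sym (u n)).
    pose proof (sqdist_ge0 (T 1%nat n (y n)) (u n)).
    assert ((1 - b) * (1 - b) <= (1 - alpha 1%nat n) * (1 - alpha 1%nat n))
      by nra. nra. }
  assert (hgap : is_lim_seq (fun n => sqdist (u n) z - sqdist (w n) z) 0).
  { apply (sqdist_gap_vanishes (B := B)); [|assumption]. intros n.
    split; [|apply hB]. unfold w. rewrite sqdist_segment.
    specialize (halpha1 n). specialize (hyz n). specialize (hTy n).
    pose proof (sqdist_ge0 (u n) (T 1%nat n (y n))).
    assert (0 <= alpha 1%nat n * (1 - alpha 1%nat n)) by nra. nra. }
  destruct (@Gamma_from_components H C alpha T a b u z k 2) as [hy hTi];
    auto.
  { intros i n hi. apply hT. lia. }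
  { intros i n hi. apply halpha. lia. }
  { intros i n hi. apply hz. lia. }
  { apply is_lim_seq_squeeze0 with (2 := is_lim_seq0_scal_l
      (/ (1 - b)) hgap). intros n.
    exact (relaxation_gap hb (halpha1 n) (conj (hTy n) (hyz n))). }
  intros i hi. destruct (Nat.eq_dec i 1) as [->|h1]; [|apply hTi; lia].
  apply is_lim_seq_squeeze0 with (2 := is_lim_seq_lincomb0 2 2 hy hsy).
  intros n. split; [apply sqdist_ge0|].
  apply (sqdist_displacement (C := C)); auto.
Qed.

Definition jointly_coherent (H : HilbertSpace) (C F : H -> Prop) (N : nat)
    (T : nat -> nat -> H -> H) (x0 : H) : Prop :=
  forall u d, (forall n, C (u n)) -> (forall n, sqdist (u n) x0 <= d) ->
    (forall j, (1 <= j <= N)%nat ->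
       is_lim_seq (fun n => sqdist (T j n (u n)) (u n)) 0) ->
    exists c, F c /\ sqdist x0 c <= d.

Lemma averaged_coherent (H : HilbertSpace) (C F : H -> Prop) (N : nat)
    (alpha : nat -> nat -> R) (T : nat -> nat -> H -> H) (a b : R)
    (x0 z : H) :
  convex_set C -> (1 <= N)%nat -> 0 < a -> b < 1 ->
  (forall i n, (1 <= i <= N)%nat -> nonexpansive C (T i n)) ->
  (forall i n, (2 <= i <= N)%nat -> a < alpha i n < b) ->
  (forall n, 0 <= alpha 1%nat n < b) ->
  (forall i n, (1 <= i <= N)%nat -> T i n z = z) -> C z ->
  jointly_coherent C F N T x0 ->
  coherent C F (averaged_map N alpha T) x0.
Proof.
  intros Cv hN ha hb hT halpha halpha1 hz Cz hJ u d Cu hd hlim.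
  apply (hJ u d Cu hd).
  apply (@Gamma_components H C N alpha T a b (2 * d + 2 * sqdist x0 z) u z);
    auto.
  - intros n. pose proof (sqdist_triangle2 (u n) x0 z). specialize (hd n).
    lra.
  (* Averaging with the identity halves the displacement, whence 4 on squares. *)
  - apply is_lim_seq_squeeze0 with (2 := is_lim_seq0_scal_l 4 hlim).
    intros n. split; [apply sqdist_ge0|].
    rewrite averaged_segment, sqdist_segment, sqdist_refl. lra.
Qed.
(** * Nonexpansive semigroups *)

Lemma converges_unique (H : HilbertSpace) (u : nat -> H) (l l' : H) :
  converges u l -> converges u l' -> l = l'.
Proof. apply (filterlim_locally_unique u). Qed.

Lemma converges_const (H : HilbertSpace) (l : H) :
  converges (fun _ => l) l.
Proof. apply filterlim_const. Qed.

Lemma is_lim_seq_subseq_ge (u : nat -> R) (l : Rbar) (f : nat -> nat) :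
  (forall n, (n <= f n)%nat) -> is_lim_seq u l ->
  is_lim_seq (fun n => u (f n)) l.
Proof.
  intros hf h P hP. destruct (h P hP) as [M hM]. exists M. intros n hn.
  apply hM. specialize (hf n). lia.
Qed.

(** The projections of [x0] onto the sets have nondecreasing distances bounded through [d], and the
    obtuse angles make them a Cauchy sequence. *)
Lemma nested_intersection (H : HilbertSpace) (D : nat -> H -> Prop)
    (x0 : H) (d : R) :
  (forall n, convex_set (D n)) ->
  (forall n u l, (forall m, D n (u m)) -> converges u l -> D n l) ->
  (forall n z, D (S n) z -> D n z) ->
  (forall n, exists c, D n c /\ sqdist x0 c <= d) ->
  exists q, (forall n, D n q) /\ sqdist x0 q <= d.
Proof.
  intros cvx clos dec ne.
  assert (dec' : forall k n z, D (n + k)%nat z -> D n z).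
  { induction k as [|k IH]; intros n z; [now rewrite Nat.add_0_r|].
    rewrite Nat.add_succ_r. intros h. now apply IH, dec. }
  assert (hex : forall n, exists p, D n p /\
    forall y, D n y -> sqdist x0 p + sqdist y p <= sqdist x0 y).
  { intros n. apply projection_exists; [|apply cvx | apply clos].
    destruct (ne n) as [c [hc _]]. now exists c. }
  destruct (choice _ hex) as [q hq].
  set (v := fun n => sqdist x0 (q n)).
  assert (gap : forall m n, (m <= n)%nat ->
    v m + sqdist (q m) (q n) <= v n).
  { intros m n hmn. rewrite (sqdist_sym (q m)). apply (hq m).
    apply dec' with (n - m)%nat. replace (m + (n - m))%nat with n by lia.
    apply (hq n). }
  assert (incr : forall n, v n <= v (S n)).
  { intros n. pose proof (gap n (S n) ltac:(lia)).
    pose proof (sqdist_ge0 (q n) (q (S n))). lra. }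
  assert (bnd : forall n, v n <= d).
  { intros n. destruct (ne n) as [c [hc hc0]].
    pose proof (proj2 (hq n) c hc). pose proof (sqdist_ge0 c (q n)).
    unfold v. lra. }
  destruct (ex_finite_lim_seq_incr _ _ incr bnd) as [l hl].
  pose proof (is_lim_seq_incr_compare _ _ hl incr) as vl.
  destruct (@sqdist_cauchy H q (fun n => l - v n)) as [p hp].
  { replace 0 with (l - l) by ring.
    apply is_lim_seq_minus'; [apply is_lim_seq_const | assumption]. }
  { intros m n hmn. pose proof (gap m n hmn). specialize (vl n).
    unfold v in *. simpl in *. lra. }
  exists p. split.
  - intros n. apply (clos n (fun m => q (n + m)%nat)).
    + intros m. apply dec' with m. apply (hq (n + m)%nat).
    + apply converges_subseq with (u := q); [intros; lia | assumption].
  - assert (d0 : 0 <= d).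
    { pose proof (bnd 0%nat). pose proof (sqdist_ge0 x0 (q 0%nat)).
      unfold v in *. lra. }
    apply le_of_forall_eps. intros e he.
    destruct (sqdist_eventually_le hp d0 he) as [M hM].
    exact (hM x0 M (le_n M) (bnd M)).
Qed.

Lemma semigroup_nonexpansive (H : HilbertSpace) (C : H -> Prop)
    (U : R -> H -> H) (t : R) :
  nonexpansive_semigroup C U -> 0 <= t -> nonexpansive C (U t).
Proof.
  intros (h1 & _ & _ & _ & h5) ht. split; [now apply h1|]. intros x y.
  now apply h5.
Qed.

Lemma semigroup_converges (H : HilbertSpace) (C : H -> Prop)
    (U : R -> H -> H) (x : H) (s : nat -> R) (t : R) :
  nonexpansive_semigroup C U -> C x -> (forall n, 0 <= s n) -> 0 <= t ->
  is_lim_seq s t -> converges (fun n => U (s n) x) (U t x).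
Proof.
  intros (_ & _ & _ & h & _) Cx hs ht hlim.
  apply (filterlim_comp _ _ _ s (fun r => U r x) _
    (within (fun r => 0 <= r) (locally t)) _); [|now apply h].
  intros P hP. generalize (hlim _ hP). intros [M hM]. exists M.
  intros n hn. apply (hM n hn). apply hs.
Qed.

Lemma semigroup_fix_mult (H : HilbertSpace) (C : H -> Prop)
    (U : R -> H -> H) (x : H) (r : R) (k : nat) :
  nonexpansive_semigroup C U -> 0 <= r -> Fix C (U r) x ->
  U (INR k * r) x = x.
Proof.
  intros (_ & h0 & hadd & _ & _) hr [Cx hx].
  induction k as [|k IH]; [simpl; rewrite Rmult_0_l; auto|].
  rewrite S_INR. replace ((INR k + 1) * r) with (r + INR k * r) by ring.
  rewrite hadd, IH; auto. apply Rmult_le_pos; [apply pos_INR | assumption].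
Qed.

Lemma dyadic_pos (s : R) (m : nat) : 0 < s -> 0 < s / 2 ^ m.
Proof. intros hs. apply Rdiv_lt_0_compat; [|apply pow_lt]; lra. Qed.

Lemma dyadic_half (s : R) (m : nat) : s / 2 ^ m = s / 2 ^ S m + s / 2 ^ S m.
Proof. simpl. field. apply pow_nonzero. lra. Qed.

Lemma is_lim_seq_dyadic (s : R) : is_lim_seq (fun m => s / 2 ^ m) 0.
Proof.
  assert (hq : Rabs (/ 2) < 1) by (rewrite Rabs_pos_eq; lra).
  apply is_lim_seq_ext with (fun m => s * (/ 2) ^ m).
  - intros m. now rewrite pow_inv.
  - exact (is_lim_seq0_scal_l s (is_lim_seq_geom _ hq)).
Qed.

(** The multiples of [s / 2 ^ m] just below [t] tend to [t], and the orbit of [q] equals [q] at all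
    of them. *)
Lemma semigroup_fix_dyadic (H : HilbertSpace) (C : H -> Prop)
    (U : R -> H -> H) (q : H) (s t : R) :
  nonexpansive_semigroup C U -> 0 < s -> 0 <= t ->
  (forall m, Fix C (U (s / 2 ^ m)) q) -> Fix C (U t) q.
Proof.
  intros hU hs ht hq. assert (Cq : C q) by apply (hq 0%nat).
  split; [assumption|].
  assert (hk : forall m, exists k, 0 <= t - INR k * (s / 2 ^ m) <= s / 2 ^ m).
  { intros m. pose proof (dyadic_pos m hs) as hr.
    destruct (nfloor_ex (t / (s / 2 ^ m))) as [k [hk1 hk2]].
    - apply Rmult_le_pos; [assumption|].
      now apply Rlt_le, Rinv_0_lt_compat.
    - exists k. apply Rmult_le_compat_r with (r := s / 2 ^ m) in hk1; [|lra].
      apply Rmult_lt_compat_r with (r := s / 2 ^ m) in hk2; [|lra].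
      replace (t / (s / 2 ^ m) * (s / 2 ^ m)) with t in hk1, hk2
        by (field; split; [apply pow_nonzero|]; lra).
      lra. }
  destruct (choice _ hk) as [k hk'].
  apply (converges_unique (u := fun m => U (INR (k m) * (s / 2 ^ m)) q)).
  - apply (semigroup_converges hU Cq); [|assumption|].
    + intros m. apply Rmult_le_pos; [apply pos_INR|].
      now apply Rlt_le, dyadic_pos.
    + apply is_lim_seq_ext
        with (fun m => t - (t - INR (k m) * (s / 2 ^ m))); [intros; ring|].
      replace t with (t - 0) at 1 by ring.
      apply is_lim_seq_minus'; [apply is_lim_seq_const|].
      exact (is_lim_seq_squeeze0 hk' (is_lim_seq_dyadic s)).
  - apply filterlim_ext with (fun _ : nat => q).
    + intros m. symmetry. apply (semigroup_fix_mult (C := C)); auto.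
      now apply Rlt_le, dyadic_pos.
    + apply converges_const.
Qed.

(** A discrete intermediate value argument: on first reaching [s] the sequence overshoots by less
    than one step. *)
Lemma slow_crossing (t : nat -> R) (s e : R) (M : nat) :
  (forall n, (M <= n)%nat -> Rabs (t (S n) - t n) < e) -> t M < s ->
  forall k, s <= t (M + k)%nat -> exists n, (M <= n)%nat /\ Rabs (t n - s) < e.
Proof.
  intros hstep hM. induction k as [|k IH].
  - rewrite Nat.add_0_r. lra.
  - intros hk. destruct (Rle_lt_dec s (t (M + k)%nat)) as [h|h]; [auto|].
    exists (S (M + k)). split; [lia|].
    rewrite Nat.add_succ_r in hk. specialize (hstep (M + k)%nat ltac:(lia)).
    apply Rabs_def2 in hstep. apply Rabs_def1; lra.
Qed.

(** Infinitely often below and above [s], with vanishing steps, [t] crosses [s] ever more closely.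
    That [f] dominates the identity suffices to transport limits. *)
Lemma intermediate_cluster_value (t : nat -> R) (s : R) :
  LimInf_seq t = Finite 0 -> Rbar_lt s (LimSup_seq t) -> 0 < s ->
  is_lim_seq (fun n => t (S n) - t n) 0 ->
  exists f, (forall n, (n <= f n)%nat) /\ is_lim_seq (fun n => t (f n)) s.
Proof.
  intros hinf hsup hs hstep.
  assert (low : forall M, exists n, (M <= n)%nat /\ t n < s).
  { intros M.
    assert (h : is_LimInf_seq t (LimInf_seq t))
      by exact (proj2_sig (ex_LimInf_seq t)).
    rewrite hinf in h.
    destruct (proj1 (h (mkposreal _ hs)) M) as [n [h1 h2]].
    exists n. split; [assumption|]. simpl in h2. lra. }
  assert (high : forall M, exists n, (M <= n)%nat /\ s < t n).
  { intros M.
    assert (h : is_LimSup_seq t (LimSup_seq t))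
      by exact (proj2_sig (ex_LimSup_seq t)).
    destruct (LimSup_seq t) as [L| |]; simpl in hsup, h.
    - assert (hL : 0 < L - s) by lra.
      destruct (proj1 (h (mkposreal _ hL)) M) as [n [h1 h2]].
      exists n. split; [assumption|]. simpl in h2. lra.
    - exact (h s M).
    - easy. }
  assert (near : forall n, exists m, (n <= m)%nat /\
    Rabs (t m - s) < / (INR n + 1)).
  { intros n.
    destruct (is_lim_seq0_eventually hstep (inv_S_pos n)) as [M hM].
    destruct (low (max M n)) as [i [hi hi']].
    destruct (high i) as [j [hj hj']].
    destruct (@slow_crossing t s (/ (INR n + 1)) i) with (k := (j - i)%nat)
      as [m [hm hm']].
    - intros m hm. apply hM. lia.
    - assumption.
    - replace (i + (j - i))%nat with j by lia. lra.
    - exists m. split; [lia | assumption]. }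
  destruct (choice _ near) as [f hf]. exists f. split; [apply hf|].
  apply is_lim_seq_ext with (fun n => (t (f n) - s) + s); [intros; ring|].
  replace (Finite s) with (Finite (0 + s)) by (f_equal; ring).
  apply is_lim_seq_plus'; [|apply is_lim_seq_const].
  apply is_lim_seq_abs_0.
  apply is_lim_seq_squeeze0 with (2 := is_lim_seq_inv_S). intros n.
  split; [apply Rabs_pos | apply Rlt_le, hf].
Qed.

(* The asymptotic centers of the subsequences along which [t] tends to
   [s / 2 ^ m] are fixed by [U j (s / 2 ^ m)] only, but these fixed point sets
   decrease with [m]. *)
Lemma semigroup_coherent (H : HilbertSpace) (C : H -> Prop) (N : nat)
    (U : nat -> R -> H -> H) (T : nat -> nat -> H -> H) (t : nat -> R)
    (x0 : H) :
  closed C -> convex_set C -> C x0 ->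
  (forall j, (1 <= j <= N)%nat -> nonexpansive_semigroup C (U j)) ->
  (forall n, 0 <= t n) ->
  LimInf_seq t = Finite 0 -> Rbar_lt (Finite 0) (LimSup_seq t) ->
  is_lim_seq (fun n => t (S n) - t n) 0 ->
  (forall j n x, (1 <= j <= N)%nat -> C x -> T j n x = U j (t n) x) ->
  (1 <= N)%nat ->
  jointly_coherent C (common_fixed_points C N U) N T x0.
Proof.
  intros Cc Cv Cx0 hU ht hinf hsup hstep hT hN u d Cu hd hlim.
  assert (hs : exists s, 0 < s /\ Rbar_lt s (LimSup_seq t)).
  { destruct (LimSup_seq t) as [L| |]; simpl in hsup.
    - exists (L / 2). simpl. lra.
    - exists 1. simpl. split; [lra|easy].
    - easy. }
  destruct hs as [s [hs hsL]].
  set (D := fun m x => forall j, (1 <= j <= N)%nat ->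
    Fix C (U j (s / 2 ^ m)) x).
  assert (hne : forall j m, (1 <= j <= N)%nat ->
    nonexpansive C (U j (s / 2 ^ m))).
  { intros j m hj. apply semigroup_nonexpansive; [now apply hU|].
    now apply Rlt_le, dyadic_pos. }
  destruct (@nested_intersection H D x0 d) as [q [hq hqd]].
  - intros m x y c hx hy hc j hj.
    apply fix_convex; auto.
  - intros m v l hv hl j hj.
    apply (fix_closed (u := v)); auto. intros n. now apply hv.
  - intros m x hx j hj. destruct (hx j hj) as [Cx ex].
    split; [assumption|]. destruct (hU j hj) as (_ & _ & hadd & _ & _).
    pose proof (dyadic_pos (S m) hs).
    rewrite dyadic_half, hadd, !ex; auto; lra.
  - intros m.
    assert (hsm : Rbar_lt (s / 2 ^ m) (LimSup_seq t)).
    { apply Rbar_le_lt_trans with s; [|assumption]. simpl.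
      induction m as [|m IH]; [simpl; lra|].
      pose proof (dyadic_pos (S m) hs). rewrite dyadic_half in IH. lra. }
    destruct (intermediate_cluster_value hinf hsm (dyadic_pos m hs) hstep)
      as [f [hf hfs]].
    destruct (@asymptotic_fixed_point H C x0 (fun n => u (f n)) d)
      as [c [Cc' [hc uniq]]]; auto.
    exists c. split; [|assumption]. intros j hj. split; [assumption|].
    (* These maps vary with [n]; their values at [c] tend to [U j (s / 2 ^ m) c] by continuity of
       the orbit. *)
    apply uniq with (S := fun n => U j (t (f n))).
    + intros n. apply semigroup_nonexpansive; auto.
    + eapply is_lim_seq_ext; [|exact (is_lim_seq_subseq_ge hf (hlim j hj))].
      intros n. cbn. now rewrite hT.
    + apply (semigroup_converges (hU j hj)); auto.
      now apply Rlt_le, dyadic_pos.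
  - exists q. split; [|assumption]. intros j r hj hr.
    apply (semigroup_fix_dyadic (s := s)); auto. intros m. now apply hq.
Qed.

(** * Means of orbits *)

Lemma is_RInt_inner (H : HilbertSpace) (f : R -> H) (a b : R) (I v : H) :
  is_RInt f a b I -> is_RInt (fun s => inner (f s) v) a b (inner I v).
Proof.
  intros h.
  assert (e : forall ptd, Riemann_sum (fun s => inner (f s) v) ptd =
    inner (Riemann_sum f ptd) v).
  { intros ptd. apply SF_cons_ind with (s := ptd).
    - intros x. symmetry. apply inner_zero_l.
    - intros [x y] s IH. rewrite !Riemann_sum_cons, IH.
      rewrite inner_plus_l, inner_scal_l. reflexivity. }
  unfold is_RInt in *.
  apply filterlim_ext with
    (fun ptd => inner (scal (sign (b - a)) (Riemann_sum f ptd)) v).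
  { intros ptd. rewrite inner_scal_l, e. reflexivity. }
  exact (filterlim_comp _ _ _ _ (fun z => inner z v) _ _ _ h
    (@inner_continuous H v I)).
Qed.

Lemma sqdist_continuous (H : HilbertSpace) (f : R -> H) (v : H) (s : R) :
  continuous f s -> continuous (fun r => sqdist (f r) v) s.
Proof.
  intros hf.
  assert (hn : continuous (fun r => norm (minus (f r) v)) s).
  { apply (continuous_comp (fun r => minus (f r) v) norm).
    - apply (continuous_minus f (fun _ => v)); [assumption|].
      apply continuous_const.
    - exact (filterlim_norm (V := H) (minus (f s) v)). }
  apply continuous_ext with
    (fun r => mult (norm (minus (f r) v)) (norm (minus (f r) v))).
  { intros r. rewrite sqdist_norm. unfold mult. simpl. ring. }
  now apply (continuous_mult (K := R_AbsRing)).
Qed.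

(** Freezing the orbit at negative times turns one-sided continuity at 0 into continuity on the
    whole line. *)
Lemma semigroup_orbit_continuous (H : HilbertSpace) (C : H -> Prop)
    (U : R -> H -> H) (x : H) (s : R) :
  nonexpansive_semigroup C U -> C x ->
  continuous (fun r => U (Rmax 0 r) x) s.
Proof.
  intros (_ & _ & _ & h & _) Cx.
  apply (filterlim_comp _ _ _ (fun r => Rmax 0 r) (fun r => U r x) _
    (within (fun r => 0 <= r) (locally (Rmax 0 s))) _);
    [|apply h; [assumption | apply Rmax_l]].
  intros P [e hP]. exists e. intros r hr. apply hP; [|apply Rmax_l].
  change (Rabs (Rmax 0 r - Rmax 0 s) < e).
  change (Rabs (r - s) < e) in hr.
  revert hr. unfold Rmax.
  destruct (Rle_dec 0 r); destruct (Rle_dec 0 s); intros hr;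
    apply Rabs_def2 in hr; apply Rabs_def1; pose proof (cond_pos e); lra.
Qed.

(** The variance identity: |f s - v|^2 - |f s - y|^2 is affine in [f s], so its integral depends
    only on the mean [y]. *)
Lemma mean_sqdist (H : HilbertSpace) (f : R -> H) (t : R) (y v : H) :
  (forall s, continuous f s) -> 0 < t ->
  y = scal (/ t) (RInt f 0 t) ->
  t * sqdist y v =
  RInt (fun s => sqdist (f s) v) 0 t - RInt (fun s => sqdist (f s) y) 0 t.
Proof.
  intros hf ht hy.
  assert (hI : is_RInt f 0 t (scal t y)).
  { replace (scal t y) with (RInt f 0 t).
    - apply RInt_correct, ex_RInt_continuous. intros; apply hf.
    - rewrite hy, scal_assoc. unfold mult. simpl.
      rewrite Rinv_r by lra. symmetry. apply (scal_one (RInt f 0 t)). }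
  assert (hc : forall w, is_RInt (fun s => sqdist (f s) w) 0 t
    (RInt (fun s => sqdist (f s) w) 0 t)).
  { intros w. apply (RInt_correct (V := R_CompleteNormedModule)).
    apply (ex_RInt_continuous (V := R_CompleteNormedModule)).
    intros. now apply sqdist_continuous. }
  pose proof (is_RInt_minus _ _ _ _ _ _ (hc v) (hc y)) as h1.
  pose proof (is_RInt_plus _ _ _ _ _ _
    (@is_RInt_inner H f 0 t (scal t y) (scal 2 (minus y v)) hI)
    (is_RInt_const 0 t (inner v v - inner y y))) as h2.
  assert (h3 : is_RInt (fun s => minus (sqdist (f s) v) (sqdist (f s) y)) 0 t
    (plus (inner (scal t y) (scal 2 (minus y v)))
       (scal (t - 0) (inner v v - inner y y)))).
  { eapply is_RInt_ext; [|exact h2]. intros s _.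
    change (inner (f s) (scal 2 (minus y v)) + (inner v v - inner y y) =
      sqdist (f s) v - sqdist (f s) y).
    expand_sqdist. ring. }
  apply (is_RInt_unique (V := R_CompleteNormedModule)) in h1, h3.
  pose proof (eq_trans (eq_sym h1) h3) as h4.
  change (RInt (fun s => sqdist (f s) v) 0 t -
    RInt (fun s => sqdist (f s) y) 0 t =
    inner (scal t y) (scal 2 (minus y v)) +
    (t - 0) * (inner v v - inner y y)) in h4.
  rewrite h4. expand_sqdist. ring.
Qed.

(* By [mean_sqdist] with [v = U h y]: shifting time by [h], the integral of
   [|U s x - U h y|^2] exceeds that of [|U s x - y|^2] at most by its part
   over [0, h]. *)
Lemma mean_displacement (H : HilbertSpace) (C : H -> Prop) (U : R -> H -> H)
    (x y z : H) (t h : R) :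
  nonexpansive_semigroup C U -> C x -> C y ->
  (forall s, 0 <= s -> Fix C (U s) z) -> 0 < t -> 0 <= h ->
  y = scal (/ t) (RInt (fun s => U s x) 0 t) -> sqdist y z <= sqdist x z ->
  sqdist (U h y) y <= 4 * sqdist x z * h * / t.
Proof.
  intros hU Cx Cy hz ht hh hy hyz.
  assert (Cz : C z) by apply (hz 0 (Rle_refl 0)).
  assert (near : forall s w, 0 <= s -> C w -> sqdist (U s w) z <= sqdist w z).
  { intros s w hs hw.
    pose proof (nonexpansive_sqdist (semigroup_nonexpansive hU hs) hw Cz) as e.
    now rewrite (proj2 (hz s hs)) in e. }
  (* If [t <= h], the crude bound [4 * sqdist x z] already suffices. *)
  destruct (Rle_lt_dec t h) as [hth|hth].
  { pose proof (sqdist_triangle2 (U h y) z y) as e.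
    rewrite (sqdist_sym z y) in e. specialize (near h y hh Cy).
    apply Rmult_le_reg_r with t; [assumption|].
    replace (4 * sqdist x z * h * / t * t) with (4 * sqdist x z * h)
      by (field; lra).
    pose proof (sqdist_ge0 x z). nra. }
  set (f := fun s => U (Rmax 0 s) x).
  assert (fU : forall s, 0 <= s -> f s = U s x).
  { intros s hs. unfold f. now rewrite Rmax_right. }
  assert (hf : forall s, continuous f s).
  { intros s. now apply semigroup_orbit_continuous with (C := C). }
  assert (hyf : y = scal (/ t) (RInt f 0 t)).
  { rewrite hy. f_equal. apply RInt_ext. intros s hs.
    rewrite Rmin_left in hs by lra. symmetry. apply fU. lra. }
  pose proof (mean_sqdist (U h y) hf ht hyf) as e.
  assert (ex : forall w c d, ex_RInt (fun s => sqdist (f s) w) c d).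
  { intros w c d. apply (ex_RInt_continuous (V := R_CompleteNormedModule)).
    intros. now apply sqdist_continuous. }
  set (I := fun w c d => RInt (fun s => sqdist (f s) w) c d).
  change (t * sqdist y (U h y) = I (U h y) 0 t - I y 0 t) in e.
  assert (c1 : I (U h y) 0 h + I (U h y) h t = I (U h y) 0 t).
  { apply (RInt_Chasles (V := R_CompleteNormedModule)); apply ex. }
  assert (c2 : I y 0 (t - h) + I y (t - h) t = I y 0 t).
  { apply (RInt_Chasles (V := R_CompleteNormedModule)); apply ex. }
  assert (pos : 0 <= I y (t - h) t).
  { apply RInt_ge_0; [lra | apply ex|]. intros s _. apply sqdist_ge0. }
  assert (head : I (U h y) 0 h <= h * (4 * sqdist x z)).
  { replace (h * (4 * sqdist x z)) with
      (RInt (fun _ => 4 * sqdist x z) 0 h).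
    - apply RInt_le; [assumption | apply ex | apply ex_RInt_const |].
      intros s hs. rewrite fU by lra.
      pose proof (sqdist_triangle2 (U s x) z (U h y)) as e2.
      rewrite (sqdist_sym z (U h y)) in e2.
      pose proof (near s x ltac:(lra) Cx). pose proof (near h y hh Cy). lra.
    - rewrite RInt_const. change ((h - 0) * (4 * sqdist x z) =
        h * (4 * sqdist x z)). ring. }
  (* For [s >= h], [U s x] is [U h (U (s - h) x)], and [U h] is nonexpansive. *)
  assert (tail : I (U h y) h t <= I y 0 (t - h)).
  { unfold I at 2. replace (RInt (fun s => sqdist (f s) y) 0 (t - h)) with
      (RInt (fun s => sqdist (f (s - h)) y) h t).
    - apply RInt_le; [lra | apply ex | |].
      + apply (ex_RInt_continuous (V := R_CompleteNormedModule)).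
        intros s _. apply sqdist_continuous.
        apply (continuous_comp (fun s => s - h) f); [|apply hf].
        apply (continuous_minus (fun s : R => s) (fun _ => h));
          [apply continuous_id | apply continuous_const].
      + intros s hs. rewrite !fU by lra.
        destruct (hU) as (self & _ & hadd & _ & _).
        replace s with (h + (s - h)) at 1 by ring. rewrite hadd by lra || auto.
        apply (nonexpansive_sqdist (semigroup_nonexpansive hU hh)); auto.
        apply self; [lra|assumption].
    - pose proof (RInt_comp_lin (V := R_CompleteNormedModule)
        (fun s => sqdist (f s) y) 1 (- h) h t (ex _ _ _)) as e2.
      replace (1 * h + - h) with 0 in e2 by ring.
      replace (1 * t + - h) with (t - h) in e2 by ring.
      rewrite <- e2. apply RInt_ext. intros s _.
      replace (1 * s + - h) with (s - h) by ring.
      symmetry. apply (scal_one (V := R_NormedModule)). }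
  rewrite (sqdist_sym y) in e.
  apply Rmult_le_reg_r with t; [assumption|].
  replace (4 * sqdist x z * h * / t * t) with (4 * sqdist x z * h)
    by (field; lra).
  lra.
Qed.

Lemma mean_fixed (H : HilbertSpace) (C : H -> Prop) (U : R -> H -> H)
    (z : H) (t : R) :
  (forall s, 0 <= s -> Fix C (U s) z) -> 0 < t ->
  scal (/ t) (RInt (fun s => U s z) 0 t) = z.
Proof.
  intros hz ht.
  replace (RInt (fun s => U s z) 0 t) with (scal t z).
  - rewrite scal_assoc. unfold mult. simpl. rewrite Rinv_l by lra.
    apply (scal_one z).
  - transitivity (RInt (fun _ => z) 0 t).
    + rewrite RInt_const. now rewrite Rminus_0_r.
    + apply RInt_ext. intros s hs. rewrite Rmin_left in hs by lra.
      symmetry. apply hz. lra.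
Qed.

Lemma mean_coherent (H : HilbertSpace) (C : H -> Prop) (N : nat)
    (U : nat -> R -> H -> H) (T : nat -> nat -> H -> H) (t : nat -> R)
    (x0 z : H) :
  closed C -> convex_set C -> C x0 ->
  (forall j n, (1 <= j <= N)%nat -> nonexpansive C (T j n)) ->
  (forall j, (1 <= j <= N)%nat -> nonexpansive_semigroup C (U j)) ->
  (forall n, 0 < t n) -> is_lim_seq t p_infty ->
  (forall j n x, (1 <= j <= N)%nat -> C x ->
     T j n x = scal (/ t n) (RInt (fun s => U j s x) 0 (t n))) ->
  common_fixed_points C N U z -> C z ->
  jointly_coherent C (common_fixed_points C N U) N T x0.
Proof.
  intros Cc Cv Cx0 hne hU ht hlimt hT hz Cz u d Cu hd hlim.
  destruct (@asymptotic_fixed_point H C x0 u d) as [c [Cc' [hc uniq]]]; auto.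
  exists c. split; [|assumption]. intros j h hj hh. split; [assumption|].
  pose proof (semigroup_nonexpansive (hU j hj) hh) as hUh.
  apply uniq with (S := fun _ => U j h); [auto | | apply converges_const].
  set (B := 2 * d + 2 * sqdist x0 z).
  assert (hB : forall n, sqdist (u n) z <= B).
  { intros n. pose proof (sqdist_triangle2 (u n) x0 z). specialize (hd n).
    unfold B. lra. }
  assert (Tz : forall n, T j n z = z).
  { intros n. rewrite hT by auto. apply (mean_fixed (C := C)); auto. }
  assert (hinv : is_lim_seq (fun n => 4 * B * h * / t n) 0).
  { apply is_lim_seq0_scal_l.
    now apply (is_lim_seq_inv t p_infty). }
  (* With [y = T j n (u n)], |U h u - u|^2 is at most 2 |y - u|^2 + 2 |U h y - u|^2, hence at most 6
     |y - u|^2 + 4 |U h y - y|^2. *)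
  apply is_lim_seq_squeeze0
    with (2 := is_lim_seq_lincomb0 6 4 (hlim j hj) hinv).
  intros n. split; [apply sqdist_ge0|].
  assert (Cy : C (T j n (u n))) by now apply (hne j n hj).
  pose proof (nonexpansive_sqdist (hne j n hj) (Cu n) Cz) as hyz.
  rewrite Tz in hyz.
  assert (disp : sqdist (U j h (T j n (u n))) (T j n (u n)) <=
    4 * sqdist (u n) z * h * / t n).
  { apply mean_displacement with (C := C); auto. }
  assert (disp' : 4 * sqdist (u n) z * h * / t n <= 4 * B * h * / t n).
  { specialize (hB n). pose proof (Rinv_0_lt_compat _ (ht n)).
    apply Rmult_le_compat_r; [lra|]. apply Rmult_le_compat_r; lra. }
  pose proof (sqdist_displacement hUh (Cu n) Cy).
  pose proof (sqdist_triangle2 (U j h (T j n (u n))) (T j n (u n)) (u n)).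
  lra.
Qed.

(** * The constant case and the conclusion common to the three cases *)

Lemma constant_coherent (H : HilbertSpace) (C : H -> Prop) (N : nat)
    (U : nat -> H -> H) (T : nat -> nat -> H -> H) (x0 : H) :
  closed C -> convex_set C -> C x0 ->
  (forall j, (1 <= j <= N)%nat -> nonexpansive C (U j)) ->
  (forall j n x, (1 <= j <= N)%nat -> C x -> T j n x = U j x) ->
  jointly_coherent C (fun x => forall j, (1 <= j <= N)%nat -> Fix C (U j) x)
    N T x0.
Proof.
  intros Cc Cv Cx0 hU hT u d Cu hd hlim.
  destruct (@asymptotic_fixed_point H C x0 u d) as [c [Cc' [hc uniq]]]; auto.
  exists c. split; [|assumption]. intros j hj. split; [assumption|].
  apply uniq with (S := fun _ => U j); [auto | | apply converges_const].
  eapply is_lim_seq_ext; [|exact (hlim j hj)]. intros n. cbn.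
  now rewrite hT.
Qed.

(** The family [V] presents [F] as an intersection of fixed point sets, which makes it closed and
    convex. Its index is [j] in case 1 and a pair of [j] and a time in the other cases. *)
Lemma convergence_from_joint_coherence (H : HilbertSpace) (C F : H -> Prop)
    (x0 : H) (N : nat) (T : nat -> nat -> H -> H) (a b : R)
    (alpha : nat -> nat -> R) (I : Type) (P : I -> Prop) (V : I -> H -> H) :
  closed C -> convex_set C -> C x0 -> (1 <= N)%nat ->
  (forall j n, (1 <= j <= N)%nat -> nonexpansive C (T j n)) ->
  0 < a -> b < 1 ->
  (forall j n, (2 <= j <= N)%nat -> a < alpha j n < b) ->
  (forall n, 0 <= alpha 1%nat n < b) ->
  (forall i, P i -> nonexpansive C (V i)) ->
  (forall x, F x <-> forall i, P i -> Fix C (V i) x) ->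
  (exists i, P i) -> (exists x, F x) ->
  (forall j n x, (1 <= j <= N)%nat -> F x -> T j n x = x) ->
  jointly_coherent C F N T x0 ->
  exists p : H,
    is_proj F x0 p /\
    (exists x, haugazeau C (averaged_map N alpha T) x0 x) /\
    (forall x, haugazeau C (averaged_map N alpha T) x0 x -> converges x p) /\
    (exists x, shrinking C (averaged_map N alpha T) x0 x) /\
    (forall x, shrinking C (averaged_map N alpha T) x0 x -> converges x p).
Proof.
  intros Cc Cv Cx0 hN hT ha hb halpha halpha1 hV hF [i0 hi0] neF hfix hJ.
  assert (FC : forall z, F z -> C z).
  { intros z hz. exact (proj1 (proj1 (hF z) hz i0 hi0)). }
  destruct (projection_exists (D := F) x0 neF) as [p [Fp hp]].
  { intros x y s hx hy hs. apply hF. intros i hi.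
    apply fix_convex; auto; now apply hF. }
  { intros u l hu hl. apply hF. intros i hi.
    apply (fix_closed (u := u)); auto. intros n. now apply hF. }
  assert (pmin : forall z, F z -> sqdist x0 p <= sqdist x0 z).
  { intros z hz. specialize (hp z hz). pose proof (sqdist_ge0 z p). lra. }
  assert (hcoh : coherent C F (averaged_map N alpha T) x0).
  { apply (@averaged_coherent H C F N alpha T a b x0 p); auto. }
  assert (hcut : forall n, cutter C F (averaged_map N alpha T n)).
  { intros n. unfold cutter, self_map.
    enough (cutter C F (fun x => segment (/ 2) (Gamma N alpha T 1 n x) x))
      as [h1 h2].
    { split; intros x; rewrite averaged_segment; auto. }
    assert (hpos : forall j, (1 <= j < 1 + (N + 1 - 1))%nat ->
      (1 <= j <= N)%nat) by (intros; lia).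
    apply averaged_cutter; auto.
    - intros z hz. split; [auto|]. apply Gamma_from_fixed.
      intros i hi. auto.
    - apply Gamma_from_nonexpansive; auto. intros i hi. split; [auto|].
      destruct (Nat.eq_dec i 1) as [->|h].
      + specialize (halpha1 n). lra.
      + specialize (halpha i n ltac:(lia)). lra. }
  exists p. split; [now apply is_proj_sqdist|]. repeat split.
  - now apply haugazeau_exists with F.
  - intros x. now apply haugazeau_converges with F.
  - now apply shrinking_exists with F.
  - intros x. now apply shrinking_converges with F.
Qed.

Lemma jointly_coherent_ext (H : HilbertSpace) (C F G : H -> Prop) (N : nat)
    (T : nat -> nat -> H -> H) (x0 : H) :
  (forall x, F x <-> G x) -> jointly_coherent C G N T x0 ->
  jointly_coherent C F N T x0.
Proof.
  intros e h u d Cu hd hlim. destruct (h u d Cu hd hlim) as [c [hc hc']].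
  exists c. split; [now apply e | assumption].
Qed.

Theorem theorem11 (H : HilbertSpace) (C : H -> Prop) (x0 : H) (N : nat)
    (T : nat -> nat -> H -> H) (F : H -> Prop)
    (a b : R) (alpha : nat -> nat -> R)
    (C_nonempty : exists x, C x)
    (C_closed : closed C)
    (C_convex : convex_set C)
    (C_x0 : C x0)
    (N_ge1 : (1 <= N)%nat)
    (T_nonexpansive : forall j n, (1 <= j <= N)%nat -> nonexpansive C (T j n))
    (T_F : constant_case C N T F \/ semigroup_case C N T F \/ mean_case C N T F)
    (ab : 0 < a /\ a < b /\ b < 1)
    (alpha_bounds : forall j n, (2 <= j <= N)%nat -> a < alpha j n < b)
    (alpha1_bounds : forall n, 0 <= alpha 1%nat n < b) :
  exists p : H,
    is_proj F x0 p /\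
    (exists x, haugazeau C (averaged_map N alpha T) x0 x) /\
    (forall x, haugazeau C (averaged_map N alpha T) x0 x -> converges x p) /\
    (exists x, shrinking C (averaged_map N alpha T) x0 x) /\
    (forall x, shrinking C (averaged_map N alpha T) x0 x -> converges x p).
Proof.
  destruct ab as [ha [_ hb]].
  destruct T_F as [(U & hT & hF & neF) |
    [(U & t & hU & ht & hinf & hsup & hstep & hT & hF & neF) |
     (U & t & hU & ht & hlim & hT & hF & neF)]].
  (* [U j] agrees on [C] with [T j 0] and inherits its nonexpansiveness. *)
  - assert (hne : forall j, (1 <= j <= N)%nat -> nonexpansive C (U j)).
    { intros j hj. destruct (T_nonexpansive j 0%nat hj) as [h1 h2].
      split.
      - intros x hx. rewrite <- (hT j 0%nat) by auto. auto.
      - intros x y hx hy. rewrite <- !(hT j 0%nat) by auto. auto. }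
    apply (@convergence_from_joint_coherence H C F x0 N T a b alpha nat
      (fun j => (1 <= j <= N)%nat) U); auto.
    + exists 1%nat. lia.
    + intros j n x hj hx. destruct (proj1 (hF x) hx j hj) as [Cx ex].
      now rewrite hT.
    + apply (jointly_coherent_ext hF). now apply constant_coherent.
  - apply (@convergence_from_joint_coherence H C F x0 N T a b alpha (nat * R)
      (fun i => (1 <= fst i <= N)%nat /\ 0 <= snd i)
      (fun i => U (fst i) (snd i))); auto.
    + intros [j s] [hj hs]. now apply semigroup_nonexpansive; [apply hU|].
    + intros x. rewrite hF. split; [intros h [j s] [hj hs]; now apply h|].
      intros h j s hj hs. now apply (h (j, s)).
    + exists (1%nat, 0). simpl. split; [lia | lra].
    + intros j n x hj hx.
      destruct (proj1 (hF x) hx j (t n) hj (ht n)) as [Cx ex].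
      now rewrite hT.
    + apply (jointly_coherent_ext hF).
      now apply semigroup_coherent with (t := t).
  - destruct neF as [z hz].
    assert (Cz : C z).
    { exact (proj1 (proj1 (hF z) hz 1%nat 0 ltac:(lia) (Rle_refl 0))). }
    apply (@convergence_from_joint_coherence H C F x0 N T a b alpha (nat * R)
      (fun i => (1 <= fst i <= N)%nat /\ 0 <= snd i)
      (fun i => U (fst i) (snd i))); auto.
    + intros [j s] [hj hs]. now apply semigroup_nonexpansive; [apply hU|].
    + intros x. rewrite hF. split; [intros h [j s] [hj hs]; now apply h|].
      intros h j s hj hs. now apply (h (j, s)).
    + exists (1%nat, 0). simpl. split; [lia | lra].
    + now exists z.
    + intros j n x hj hx. pose proof (proj1 (hF x) hx) as hx'.
      rewrite hT by (exact (proj1 (hx' j 0 hj (Rle_refl 0))) || exact hj).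
      apply (mean_fixed (C := C)); auto.
    + apply (jointly_coherent_ext hF).
      apply mean_coherent with (U := U) (t := t) (z := z); auto.
      now apply hF.
Qed.
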